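(* Let $\alpha\in(0,2)$. Let $\{\xi_k,k\ge1\}$ be i.i.d. real random variables and $(a_n)$ a sequence of positive constants such that $$\frac{1}{a_n}\sum_{k=1}^n\xi_k\stackrel{d}{\longrightarrow}S,$$ where $S$ is a stable random variable with characteristic function $\mathbb{E}(e^{itS})=e^{-|t|^\alpha}$. Let $\{W_{nk}: n\ge1,\ 1\le k\le n\}$ be an array of real random variables independent of $\{\xi_k\}$. Suppose that (A5) $\frac1n\sum_{k=1}^n|W_{nk}|^\alpha$ converges in distribution, as $n\to\infty$, to $F$, where $F$ is some (probability) distribution function; (A6) there exists $\beta\ge1$ with $\beta>\alpha$ such that $\lim_{c\to\infty}\sup_n\frac1n\sum_{k=1}^n\mathbb{E}\big(|W_{nk}|^\beta I(|W_{nk}|>c)\big)=0$. Then $$\frac1{a_n}\sum_{k=1}^nW_{nk}\xi_k\stackrel{d}{\longrightarrow}W^{1/\alpha}S,$$ where $W$ is a non-negative random variable with distribution function $F$, independent of $S$.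
   Context: The whole array $\{W_{nk}\}$ is independent of the whole sequence $\{\xi_k\}$; no independence or exchangeability among the weights $W_{nk}$ is assumed. $I(\cdot)$ is the indicator function. *)

(* Defs.v *)
From HB Require Import structures.
From mathcomp Require Import all_boot all_order all_algebra finmap complex.
From mathcomp Require Import all_classical all_reals all_analysis.
From mathcomp Require Import measurable_realfun.

Set Implicit Arguments.
Unset Strict Implicit.
Unset Printing Implicit Defensive.

Import Order.TTheory GRing.Theory Num.Theory.
Import numFieldTopology.Exports numFieldNormedType.Exports.

Local Open Scope classical_set_scope.
Local Open Scope ring_scope.

Section real_measurable_functions.
Context d (T : measurableType d) (R : realType).

Definition mfun_power (p : R) (X : {mfun T >-> R}) : T -> R := fun w => X w `^ p.

Lemma measurable_mfun_power p X : measurable_fun setT (mfun_power p X).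
Proof.
exact: (@measurableT_comp _ _ _ _ _ _ (@powR R ^~ p) _ X (measurable_powR p)).
Qed.

HB.instance Definition _ p X :=
  isMeasurableFun.Build _ _ _ _ (mfun_power p X) (measurable_mfun_power p X).

Definition mfun_abs_power (p : R) (X : {mfun T >-> R}) : T -> R :=
  fun w => `|X w| `^ p.

Lemma measurable_mfun_abs_power p X : measurable_fun setT (mfun_abs_power p X).
Proof.
apply: (@measurableT_comp _ _ _ _ _ _ (@powR R ^~ p) _ (fun w => `|X w|)).
  exact: measurable_powR.
exact: measurableT_comp.
Qed.

HB.instance Definition _ p X :=
  isMeasurableFun.Build _ _ _ _ (mfun_abs_power p X) (measurable_mfun_abs_power p X).

(* Arrays and sequences are indexed from 1: entries with k = 0 or k > n are
   never used. *)
Definition row_sum (b : nat -> R) (Y : nat -> nat -> {mfun T >-> R}) (n : nat) :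
    T -> R :=
  fun w => (b n)^-1 * \sum_(1 <= k < n.+1) Y n k w.

Lemma measurable_row_sum b Y n : measurable_fun setT (row_sum b Y n).
Proof.
by apply: measurable_funM => //; apply: measurable_sum => k; exact: measurable_funP.
Qed.

HB.instance Definition _ b Y n :=
  isMeasurableFun.Build _ _ _ _ (row_sum b Y n) (measurable_row_sum b Y n).

End real_measurable_functions.

(* [{RV P >-> R}] does not record [P] up to conversion: the probability is
   therefore kept explicit below. *)
Section random_variables.
Context d (T : measurableType d) (R : realType) (P : probability T R).

Definition tail_moment (beta c : R) (X : {RV P >-> R}) : \bar R :=
  'E_P[fun w => `|X w| `^ beta * \1_[set v | c < `|X v|] w].

Definition char_fun (X : {RV P >-> R}) (t : R) : R[i] :=
  (fine 'E_P[fun w => cos (t * X w)] +i* fine 'E_P[fun w => sin (t * X w)])%C.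

Definition has_distribution_function (X : {RV P >-> R}) (F : R -> R) :=
  forall x, cdf X x = (F x)%:E.

Definition cvg_in_distribution_to (X : nat -> {RV P >-> R}) (F : R -> R) :=
  forall x, {for x, continuous F} -> cdf (X n) x @[n --> \oo] --> (F x)%:E.

Definition mutually_independent (I : choiceType) (D : set I)
    (X : I -> {RV P >-> R}) :=
  forall (J : {fset I}) (B : I -> set R), [set` J] `<=` D ->
    (forall i, measurable (B i)) ->
    P (\bigcap_(i in [set` J]) X i @^-1` B i) =
    (\prod_(i <- J) P (X i @^-1` B i))%E.

Definition identically_distributed (I : Type) (D : set I)
    (X : I -> {RV P >-> R}) :=
  forall i j, D i -> D j -> forall B : set R, measurable B ->
    distribution P (X i) B = distribution P (X j) B.

Definition iid (I : choiceType) (D : set I) (X : I -> {RV P >-> R}) :=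
  mutually_independent D X /\ identically_distributed D X.

Definition family_sigma_algebra (I : Type) (D : set I)
    (X : I -> {RV P >-> R}) : set (set T) :=
  <<s \bigcup_(i in D) preimage_set_system setT (X i) measurable >>.

Definition independent_families (I I' : Type) (D : set I) (D' : set I')
    (X : I -> {RV P >-> R}) (Y : I' -> {RV P >-> R}) :=
  forall A B, family_sigma_algebra D X A -> family_sigma_algebra D' Y B ->
    P (A `&` B) = (P A * P B)%E.

Definition independent_RVs (X Y : {RV P >-> R}) :=
  forall A B : set R, measurable A -> measurable B ->
    P (X @^-1` A `&` Y @^-1` B) = (P (X @^-1` A) * P (Y @^-1` B))%E.

End random_variables.

Arguments tail_moment {d T R} P beta c X.
Arguments char_fun {d T R} P X t.
Arguments has_distribution_function {d T R} P X F.
Arguments cvg_in_distribution_to {d T R} P X F.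
Arguments mutually_independent {d T R} P {I} D X.
Arguments identically_distributed {d T R} P {I} D X.
Arguments iid {d T R} P {I} D X.
Arguments independent_families {d T R} P {I I'} D D' X Y.
Arguments independent_RVs {d T R} P X Y.

Definition cvg_in_distribution d d' (T : measurableType d)
    (T' : measurableType d') (R : realType) (P : probability T R)
    (P' : probability T' R) (X : nat -> {RV P >-> R}) (Y : {RV P' >-> R}) :=
  cvg_in_distribution_to P X (fun x => fine (cdf Y x)).

Arguments cvg_in_distribution {d d' T T' R} P P' X Y.

(* Main.v *)
(** We compare characteristic functions.  Write [phi] for the one of [xi 1].
  Since [W] is independent of [xi], that of the weighted sum at [t] is the
  expectation of the product of the [phi (t W_nk / a_n)] over [k <= n].
  Convergence of [phi (t / a_n) ^ n] to [exp (- |t|^alpha)], uniformly for [t]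
  in compact sets, gives [n (1 - phi (t / a_n)) --> |t|^alpha], again uniformly
  on compact sets: the argument of [phi (t / a_n) ^ n] cannot wind, by the
  intermediate value theorem.  It also forces [a_n --> oo] and bounded ratios
  [a_(n+1) / a_n], whence [|1 - phi (2 u)| <= 2^beta |1 - phi u|] near [0] for
  [beta > alpha], a Potter-type bound that yields
  [n |1 - phi (t / a_n)| <= C t^beta] for [t >= 1].  Each factor is thus close
  to [exp (- |t W_nk|^alpha / n)] where [W_nk] is bounded, while (A6) controls
  the other factors in the mean; so the characteristic function of the weighted
  sum is asymptotically the Laplace transform of [n^-1 sum_k |W_nk|^alpha] at
  [|t|^alpha], which converges by (A5) to the characteristic function of
  [W^(1/alpha) S].

  Levy's continuity theorem is proved without tightness: the functions
  [atan (c (x - a)) - atan (c (x - b))] are uniform limits of Riemann sums of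
  Cauchy kernels, and [1 + 1 / (1 + x^2)] is the integral of
  [exp (- t) (1 + cos (t x))] over [t >= 0]. *)
Require Import Defs.
From HB Require Import structures.
From mathcomp Require Import all_boot all_order all_algebra finmap complex.
From mathcomp Require Import all_classical all_reals all_analysis.
From mathcomp Require Import measurable_realfun ring lra.

Set Implicit Arguments.
Unset Strict Implicit.
Unset Printing Implicit Defensive.

Import Order.TTheory GRing.Theory Num.Theory.
Import numFieldTopology.Exports numFieldNormedType.Exports.

Local Open Scope classical_set_scope.
Local Open Scope ring_scope.

Local Notation normc := ComplexField.Normc.normc.
Local Notation Re := complex.Re.
Local Notation Im := complex.Im.

(** * Expectations of bounded functions and weak convergence *)

(** Uniformity on compact sets is forced by the weights: for a single [n], the function [phi] is
    evaluated at all the random points [t W_nk / a_n] at once. It is obtained by testing weak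
    convergence simultaneously against all functions bounded by 1 with a common Lipschitz constant.
    Compact sets alone do not suffice, since the weights are unbounded: a factor at a large [W_nk]
    costs about [C |t W_nk|^beta / n], and the sum over [k] reproduces the average in (A6). Here [C]
    must not depend on the truncation level, because that level is chosen in terms of [C]. The
    bounded ratios [a_(n+1) / a_n] write every small [u] as [t / a_n] with [t] in a fixed compact
    subset of []0, 1]], where the limit [t^alpha] stays away from 0; the gap between [2^alpha] and
    [2^beta] then absorbs the error in the doubling bound. As [phi] is complex, [phi ^ n] determines
    [n (1 - phi)] only once a branch of the root is known; [atan] of the quotient of the imaginary
    and real parts replaces a complex logarithm. In the continuity theorem, the summand 1 in
    [1 + 1 / (1 + x^2)] makes the integrand non-negative, so that Tonelli's theorem applies. *)

Section bounded_expectation.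
Context d (T : measurableType d) (R : realType) (P : probability T R).
Implicit Types (f g h : T -> R) (X : {mfun T >-> R}).

Lemma bounded_integrable f (M : R) : measurable_fun setT f ->
  (forall w, `|f w| <= M) -> P.-integrable setT (EFin \o f).
Proof.
move=> mf fM; apply: measurable_bounded_integrable => //.
  by rewrite (le_lt_trans (probability_le1 _ _)) ?ltry.
by exists M; split=> [|x Mx w _ /=]; [exact: num_real|rewrite (le_trans (fM w))// ltW].
Qed.

Lemma Rintegral_prob_cst (r : R) : \int[P]_w r = r.
Proof. by rewrite Rintegral_cst// [X in fine X](@probability_setT _ _ _ P) mulr1. Qed.

Lemma normr_Rintegral_le f (M : R) : measurable_fun setT f ->
  (forall w, `|f w| <= M) -> `|\int[P]_w f w| <= M.
Proof.
move=> mf fM; have intf := bounded_integrable mf fM.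
apply: (le_trans (le_normr_Rintegral measurableT intf)).
rewrite -[leRHS]Rintegral_prob_cst; apply: le_Rintegral => //.
  by apply: (bounded_integrable (M := M)); [exact: measurableT_comp|
    move=> w; rewrite normr_id].
by apply: (bounded_integrable (M := `|M|)) => // w; rewrite normr_id.
Qed.

Lemma normr_RintegralB_le f g h :
  P.-integrable setT (EFin \o f) -> P.-integrable setT (EFin \o g) ->
  P.-integrable setT (EFin \o h) -> (forall w, `|f w - g w| <= h w) ->
  `|\int[P]_w f w - \int[P]_w g w| <= \int[P]_w h w.
Proof.
move=> intf intg inth fgh; rewrite -RintegralB//.
have intfg : P.-integrable setT (EFin \o (fun w => f w - g w)).
  by have := integrableB measurableT intf intg; apply: eq_integrable => // w _ /=; rewrite EFinB.
apply: (le_trans (le_normr_Rintegral measurableT intfg)).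
apply: le_Rintegral => //.
have := integrable_norm intfg.
by apply: eq_integrable.
Qed.

Lemma Rintegral_indicator_cdf X (x : R) :
  \int[P]_w (X w <= x)%R%:R = fine (cdf (P := P) X x).
Proof.
have mA : measurable (X @^-1` `]-oo, x]) by exact: measurable_funPTI.
rewrite /cdf /distribution /pushforward -[X in fine (P X)]setIT -integral_indic//.
congr fine; apply: eq_integral => w _ /=.
by rewrite indicE; congr ((nat_of_bool _)%:R%:E); apply/idP/idP => [Xx|];
  [rewrite inE/= in_itv|rewrite inE/= in_itv].
Qed.

End bounded_expectation.

Arguments bounded_integrable {d T R P f} M _ _.
Arguments normr_RintegralB_le {d T R P f g} h _ _ _ _.

(** A monotone function has countably many discontinuities, which form a Lebesgue-null set, whereas
    []a, b[] has positive measure. *)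
Lemma nondecreasing_continuity_point (R : realType) (F : R -> R) (a b : R) :
  a < b -> nondecreasing F ->
  exists x, a < x < b /\ {for x, continuous F}.
Proof.
move=> ab ndF.
pose A := [set x | x \in (`]a, b[) /\ discontinuity F x].
have cA : countable A by apply: discontinuity_countable => x y _ _; exact: ndF.
have [x xab NDx] : exists2 x, x \in `]a, b[ & ~ discontinuity F x.
  apply: contrapT => H; have : lebesgue_measure (`]a, b[%classic : set R) = 0%E.
    apply/countable_lebesgue_measure0/(sub_countable _ cA).
    apply/subset_card_le => x xab; split => //.
    by apply: contrapT => Dx; apply: H; exists x.
  rewrite lebesgue_measure_itv/= lte_fin ab -EFinD => /eqP.
  by rewrite eqe subr_eq0 gt_eqF.
exists x; split; first by move: xab; rewrite in_itv.
have cl : cvg (F y @[y --> x^'-]).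
  apply: nondecreasing_at_left_is_cvgr; near=> y; first by move=> u v _ _; exact: ndF.
  exists (F x) => _ [z /= + <-]; rewrite in_itv/= => /andP[_ /ltW]; exact: ndF.
have cr : cvg (F y @[y --> x^'+]).
  apply: nondecreasing_at_right_is_cvgr; near=> y; first by move=> u v _ _; exact: ndF.
  exists (F x) => _ [z /= + <-]; rewrite in_itv/= => /andP[/ltW + _]; exact: ndF.
have lr : lim (F y @[y --> x^'-]) = lim (F y @[y --> x^'+]).
  by apply/eqP/negPn/negP => H; apply: NDx; split.
(* Monotonicity squeezes [F x] between the two one-sided limits, which agree. *)
have lF : lim (F y @[y --> x^'-]) = F x.
  apply/eqP; rewrite eq_le; apply/andP; split.
    by apply: limr_le => //; near=> y; apply: ndF; near: y; exact: nbhs_left_le.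
  rewrite lr; apply: limr_ge => //; near=> y; apply: ndF; near: y; exact: nbhs_right_ge.
by apply/left_right_continuousP; split; [rewrite -lF|rewrite -lF lr].
Unshelve. all: by end_near. Qed.

Section cdf_fine.
Context d (T : measurableType d) (R : realType) (P : probability T R).
Variable Y : {mfun T >-> R}.
Local Notation G := (fun x => fine (cdf (P := P) Y x)).

Lemma fine_cdf_nondecreasing : nondecreasing G.
Proof.
move=> x y xy; apply: fine_le; rewrite ?fin_num_measure//.
exact: (cdf_nondecreasing (P := P)).
Qed.

Lemma fine_cdf_le1 x : G x <= 1.
Proof. by rewrite -lee_fin fineK ?fin_num_measure// (cdf_le1 (P := P)). Qed.

Lemma fine_cdf_ge0 x : 0 <= G x.
Proof. by rewrite fine_ge0// (cdf_ge0 (P := P)). Qed.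

Lemma fine_cdf_small e : 0 < e -> exists x, G x <= e.
Proof.
move=> e0; have /fine_cvgP[_ /cvgrPdist_le/(_ _ e0)] := cvg_cdfNy0 (P := P) Y.
move=> /filter_ex[x /=].
rewrite sub0r normrN ger0_norm; first by exists x.
exact: fine_cdf_ge0.
Qed.

Lemma fine_cdf_large e : 0 < e -> exists x, 1 - G x <= e.
Proof.
move=> e0; have /fine_cvgP[_ /cvgrPdist_le/(_ _ e0)] := cvg_cdfy1 (P := P) Y.
move=> /filter_ex[x /=].
rewrite ger0_norm; first by exists x.
by rewrite subr_ge0 fine_cdf_le1.
Qed.

End cdf_fine.

(** * Approximation of Lipschitz functions by step functions *)

Section step_function.
Context (R : realType) (f : R -> R) (p : nat -> R).

(** For [x <= p m] the sum telescopes to [f] at the first grid point that is at least [x]; beyond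
    [p m] the value is [f (p m)]. This summed-by-parts form is linear in the indicators of
    [x <= p j], so its expectation is linear in the values of the distribution function. *)
Definition step_function m (x : R) :=
  f (p m) + \sum_(0 <= j < m) (f (p j) - f (p j.+1)) * (x <= p j)%R%:R.

Lemma step_functionS m x : step_function m.+1 x =
  if x <= p m then step_function m x else
  f (p m.+1) + \sum_(0 <= j < m) (f (p j) - f (p j.+1)) * (x <= p j)%R%:R.
Proof.
rewrite /step_function big_nat_recr//=; case: ifPn => _ /=.
  rewrite mulr1; lra.
by rewrite mulr0 addr0.
Qed.

Hypothesis ndp : forall j, p j <= p j.+1.

Lemma step_function_gt m x : p m < x -> step_function m x = f (p m).
Proof.
move=> pmx; rewrite /step_function big_nat big1 ?addr0// => j /= jm.
rewrite leNgt (le_lt_trans _ pmx) ?mulr0//.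
by apply: (homo_leq (r := <=%R)) => //; [exact: le_trans|exact: ltnW].
Qed.

End step_function.

Section step_function_approximation.
Context (R : realType) (f : R -> R) (p : nat -> R) (L eta : R).
Hypothesis f1 : forall x, `|f x| <= 1.
Hypothesis fL : forall x y, `|f x - f y| <= L * `|x - y|.
Hypothesis L0 : 0 <= L.
Hypothesis ndp : forall j, p j <= p j.+1.
Hypothesis mesh : forall j, p j.+1 - p j <= eta.

Lemma step_function_le_head m x : x <= p 0%N -> step_function f p m x = f (p 0%N).
Proof.
move=> x0; elim: m => [|m IH]; first by rewrite /step_function big_geq// addr0.
rewrite step_functionS ifT//; apply: (le_trans x0).
by apply: (homo_leq (r := <=%R)) => //; exact: le_trans.
Qed.

Lemma step_function_approx_mid m x : p 0%N < x -> x <= p m ->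
  `|f x - step_function f p m x| <= L * eta.
Proof.
move=> x0; elim: m => [|m IH] xm; first by rewrite leNgt x0 in xm.
rewrite step_functionS; case: (leP x (p m)) => [|mx]; first exact: IH.
rewrite big_nat big1 ?addr0 => [|j /= jm].
  apply: (le_trans (fL _ _)); rewrite ler_wpM2l// ler0_norm ?subr_le0//.
  by apply: le_trans (mesh m); rewrite opprB lerB// ltW.
rewrite leNgt (le_lt_trans _ mx) ?mulr0//.
by apply: (homo_leq (r := <=%R)) => //; [exact: le_trans|exact: ltnW].
Qed.

(** Inside the grid the error is the Lipschitz constant times the mesh; outside only the trivial
    bound 2 holds. The two exceptional sets appear as indicators so that they integrate to tails of
    a distribution function. *)
Lemma step_function_approx m x : `|f x - step_function f p m x| <=
  L * eta + (2 * (x <= p 0%N)%R%:R + 2 * (1 - (x <= p m)%R%:R)).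
Proof.
have eta0 : 0 <= L * eta.
  by rewrite mulr_ge0// (le_trans _ (mesh 0%N))// subr_ge0.
have two u v : `|f u - f v| <= 2.
  by rewrite (le_trans (ler_normB _ _))// (_ : 2 = 1 + 1)// lerD.
have [x0|x0] := leP x (p 0%N).
  rewrite step_function_le_head//; apply: (le_trans (two _ _)).
  by case: (x <= _) => /=; lra.
have [xm|xm] := leP x (p m).
  by rewrite /= subrr !mulr0 !addr0; exact: step_function_approx_mid.
rewrite step_function_gt// /=; apply: (le_trans (two _ _)); lra.
Qed.

End step_function_approximation.

Lemma lipschitz_continuous (R : realType) (f : R -> R) (L : R) : 0 <= L ->
  (forall x y, `|f x - f y| <= L * `|x - y|) -> continuous f.
Proof.
move=> L0 fL x; apply/cvgrPdist_le => e e0.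
near=> y; apply: (le_trans (fL _ _)).
have : `|x - y| <= e / (L + 1).
  by near: y; apply: cvgr_dist_le => //; rewrite divr_gt0// ltr_wpDl.
rewrite ler_pdivlMr ?ltr_wpDl//; apply: le_trans.
by rewrite mulrC ler_wpM2l// lerDl.
Unshelve. all: by end_near. Qed.

Section step_function_expectation.
Context d (T : measurableType d) (R : realType) (P : probability T R).
Variables (X : {mfun T >-> R}) (f : R -> R) (p : nat -> R).
Local Notation G := (fun x => fine (cdf (P := P) X x)).

Lemma measurable_mfun_le (x : R) : measurable_fun setT (fun w => (X w <= x)%R%:R : R).
Proof.
rewrite (_ : (fun _ => _) = \1_(X @^-1` `]-oo, x])).
  by apply: measurable_indic; exact: measurable_funPTI.
apply/funext => w; rewrite indicE; congr (nat_of_bool _)%:R; apply/idP/idP => [Xx|];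
  by rewrite inE/= in_itv.
Qed.

Lemma integrable_mfun_le (x : R) :
  P.-integrable setT (EFin \o (fun w => (X w <= x)%R%:R : R)).
Proof.
apply: (bounded_integrable 1); first exact: measurable_mfun_le.
by move=> w; case: (X w <= x); rewrite ?normr1 ?normr0.
Qed.

Lemma integrable_step_function m :
  P.-integrable setT (EFin \o (fun w => step_function f p m (X w))).
Proof.
have ic : P.-integrable setT (EFin \o (fun _ : T => f (p m))).
  by apply: (bounded_integrable `|f (p m)|).
have isum : P.-integrable setT (fun w => \sum_(0 <= j < m)
    (f (p j) - f (p j.+1))%:E * ((X w <= p j)%R%:R : R)%:E)%E.
  apply: integrable_sum => // j _; apply: integrableZl => //.
  exact: integrable_mfun_le.
have := integrableD measurableT ic isum.
apply: eq_integrable => // w _ /=.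
by rewrite EFinD -sumEFin; congr (_ + _)%E; apply: eq_bigr => j _; rewrite EFinM.
Qed.

Lemma Rintegral_step_function m : \int[P]_w step_function f p m (X w) =
  f (p m) + \sum_(0 <= j < m) (f (p j) - f (p j.+1)) * G (p j).
Proof.
elim: m => [|m IH].
  rewrite big_geq// addr0 -[RHS](Rintegral_prob_cst P).
  by apply: eq_Rintegral => w _; rewrite /step_function big_geq// addr0.
rewrite (@eq_Rintegral _ _ _ P setT (fun w => step_function f p m (X w) +
   (f (p m.+1) - f (p m) + (f (p m) - f (p m.+1)) * (X w <= p m)%R%:R))); last first.
  by move=> w _; rewrite /step_function big_nat_recr//=; lra.
have ic r : P.-integrable setT (EFin \o (fun _ : T => r : R)).
  by apply: (bounded_integrable `|r|).
have iz r : P.-integrable setT (EFin \o (fun w => r * (X w <= p m)%R%:R)).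
  have := integrableZl measurableT r (integrable_mfun_le (p m)).
  by apply: eq_integrable => // w _ /=; rewrite EFinM.
have icz r s : P.-integrable setT (EFin \o (fun w => s + r * (X w <= p m)%R%:R)).
  have := integrableD measurableT (ic s) (iz r).
  by apply: eq_integrable => // w _ /=; rewrite EFinD.
rewrite RintegralD//; last exact: integrable_step_function.
rewrite IH RintegralD// RintegralZl//; last exact: integrable_mfun_le.
rewrite Rintegral_indicator_cdf Rintegral_prob_cst big_nat_recr//=; lra.
Qed.

End step_function_expectation.

(** * Weak convergence, uniformly over a class of Lipschitz test functions *)

Section helly_bray.
Context d d' (T : measurableType d) (T' : measurableType d') (R : realType).
Variables (P : probability T R) (P' : probability T' R).
Variables (X : nat -> {mfun T >-> R}) (Y : {mfun T' >-> R}).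
Hypothesis XY : cvg_in_distribution P P' X Y.
Local Notation Fn := (fun n x => fine (cdf (P := P) (X n) x)).
Local Notation G := (fun x => fine (cdf (P := P') Y x)).

Lemma cvg_in_distribution_sum (p : nat -> R) (m : nat) (e : R) : 0 < e ->
  (forall j, {for p j, continuous G}) ->
  \forall n \near \oo, \sum_(0 <= j < m) `|Fn n (p j) - G (p j)| <= e.
Proof.
move=> e0 cp; elim: m e e0 => [|m IH] e e0.
  by near=> n; rewrite big_geq// ltW.
have e20 : 0 < e / 2 by rewrite divr_gt0.
have /fine_cvgP[_ /cvgrPdist_le/(_ _ e20) h] := XY (cp m).
near=> n; rewrite big_nat_recr//= [e]splitr lerD//; first by near: n; exact: IH.
by rewrite distrC; near: n.
Unshelve. all: by end_near. Qed.

(* The bound is uniform in the test function: this is what makes the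
   characteristic functions converge uniformly on compact sets. *)
Lemma cvg_lipschitz_expectation (L e : R) : 0 <= L -> 0 < e ->
  \forall n \near \oo, forall f : R -> R, (forall x, `|f x| <= 1) ->
    (forall x y, `|f x - f y| <= L * `|x - y|) ->
    `|\int[P]_w f (X n w) - \int[P']_w f (Y w)| <= e.
Proof.
move=> L0 e0.
(* The error budget is at most [30 * dl]: approximation by step functions costs [8 + 2 + 2] units
   for [Y] and [8 + 4 + 4] for [X n], whose tails are within [dl] of those of [Y]; comparing the two
   step functions costs 2 more. *)
have [dl [dl0 dlE]] : exists dl : R, 0 < dl /\ e = 32 * dl.
  by exists (e / 32); split; [rewrite divr_gt0|field].
have [eta [eta0 Leta]] : exists eta : R, 0 < eta /\ L * (2 * eta) <= 8 * dl.
  have L10 : L + 1 != 0 by rewrite gt_eqF// ltr_wpDl.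
  have L1 : 0 < L + 1 by rewrite ltr_wpDl.
  exists (dl / (L + 1)); split; first by rewrite divr_gt0.
  have : L * (dl / (L + 1)) <= dl.
    by rewrite mulrA ler_pdivrMr// mulrC (ler_wpM2l (ltW dl0))// lerDl.
  lra.
have [u Gu] := fine_cdf_small P' Y dl0.
have [v Gv] := fine_cdf_large P' Y dl0.
have ndG := fine_cdf_nondecreasing P' Y.
(* One continuity point of [G] in each of the consecutive slots of length [eta]: the grid is then
   ordered, its gaps are at most [2 * eta], and [p 0] lies in the left tail. *)
have /choice[p hp] : forall j : nat, exists x : R,
    u - eta + j%:R * eta < x < u + j%:R * eta /\ {for x, continuous G}.
  by move=> j; apply: nondecreasing_continuity_point => //; lra.
have ndp j : p j <= p j.+1.
  have [/andP[_ h1] _] := hp j; have [/andP[+ _] _] := hp j.+1.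
  rewrite -natr1; lra.
have mesh j : p j.+1 - p j <= 2 * eta.
  have [/andP[h1 _] _] := hp j; have [/andP[_ +] _] := hp j.+1.
  rewrite -natr1; lra.
have [m vm] : exists m, v <= p m.
  pose m := Num.bound ((v - u + eta) / eta); exists m.
  have [/andP[+ _] _] := hp m.
  have [h|] := leP 0 ((v - u + eta) / eta).
    have := archi_boundP h; rewrite -/m ltr_pdivrMr// => h2 h3; lra.
  rewrite pmulr_llt0 ?invr_gt0//.
  have : 0 <= m%:R * eta by rewrite mulr_ge0// ltW.
  lra.
have p0u : p 0%N <= u by have [/andP[_ +] _] := hp 0%N; rewrite mul0r addr0 => /ltW.
have Gp0 : G (p 0%N) <= dl by apply: le_trans Gu; exact: ndG.
have Gpm : 1 - G (p m) <= dl by apply: le_trans Gv; rewrite lerB//; exact: ndG.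
(* The index [n] is fixed before [f]: only the distribution functions at the grid points have to be
   close, and the grid depends on [L] and [e] but not on [f]. *)
near=> n => f f1 fL.
have Fsum : \sum_(0 <= j < m.+1) `|Fn n (p j) - G (p j)| <= dl.
  by near: n; apply: cvg_in_distribution_sum => // j; have [] := hp j.
have term j : (j <= m)%N -> `|Fn n (p j) - G (p j)| <= dl.
  move=> jm; apply: le_trans Fsum.
  have jin : j \in index_iota 0 m.+1 by rewrite mem_index_iota.
  rewrite (bigD1_seq j jin (iota_uniq _ _))/=.
  by rewrite lerDl sumr_ge0.
have mf : measurable_fun setT f.
  by apply: continuous_measurable_fun; exact: lipschitz_continuous fL.
have approx d0 (T0 : measurableType d0) (P0 : probability T0 R) (Z : {mfun T0 >-> R}) :
    `|\int[P0]_w f (Z w) - \int[P0]_w step_function f p m (Z w)| <=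
    L * (2 * eta) + (2 * fine (cdf (P := P0) Z (p 0%N)) +
                     2 * (1 - fine (cdf (P := P0) Z (p m)))).
  have ib (g : T0 -> R) : measurable_fun setT g -> (forall w, `|g w| <= 1) ->
    P0.-integrable setT (EFin \o g) by exact: bounded_integrable.
  have iZ := integrable_step_function P0 Z f p m.
  have if_ : P0.-integrable setT (EFin \o (fun w => f (Z w))).
    by apply: ib => //; exact: measurableT_comp.
  have mh : measurable_fun setT (fun w : T0 => 2 * (Z w <= p 0%N)%R%:R +
      2 * (1 - (Z w <= p m)%R%:R) : R).
    apply: measurable_funD; apply: measurable_funM => //.
      exact: measurable_mfun_le.
    by apply: measurable_funB => //; exact: measurable_mfun_le.
  have ic (r : R) : P0.-integrable setT (EFin \o (fun _ : T0 => r)).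
    exact: (bounded_integrable `|r|).
  have i1 (r s q : R) : P0.-integrable setT (EFin \o (fun w => r + s * (Z w <= q)%R%:R)).
    apply: (bounded_integrable (`|r| + `|s|)) => [|w].
      apply: measurable_funD => //; apply: measurable_funM => //.
      exact: measurable_mfun_le.
    by apply: (le_trans (ler_normD _ _)); rewrite lerD2l; case: (Z w <= q) => /=;
      rewrite ?mulr1 ?mulr0 ?normr0.
  have RE (r s q : R) : \int[P0]_w (r + s * (Z w <= q)%R%:R) =
     r + s * fine (cdf (P := P0) Z q).
    rewrite RintegralD//; last by have := i1 0 s q; apply: eq_integrable => // w _ /=; rewrite add0r.
    rewrite Rintegral_prob_cst RintegralZl ?Rintegral_indicator_cdf//.
    exact: integrable_mfun_le.
  apply: (le_trans (normr_RintegralB_le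
    (fun w => (L * (2 * eta) + 2 * (Z w <= p 0%N)%R%:R) +
                   (2 + - 2 * (Z w <= p m)%R%:R)) _ _ _ _)) => //.
  - have := integrableD measurableT (i1 (L * (2 * eta)) 2 (p 0%N)) (i1 2 (- 2) (p m)).
    by apply: eq_integrable.
  - move=> w; apply: (le_trans (step_function_approx f1 fL L0 ndp mesh m _)); lra.
  by rewrite RintegralD// !RE; lra.
have h1 := approx _ _ P (X n); have h2 := approx _ _ P' Y.
have h3 : `|\int[P]_w step_function f p m (X n w) -
    \int[P']_w step_function f p m (Y w)| <= 2 * dl.
  rewrite !Rintegral_step_function opprD addrACA subrr add0r -sumrB.
  apply: (le_trans (ler_norm_sum _ _ _)).
  apply: (@le_trans _ _ (\sum_(0 <= j < m) 2 * `|Fn n (p j) - G (p j)|)).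
    apply: ler_sum => j _; rewrite -mulrBr normrM ler_wpM2r//.
    by rewrite (le_trans (ler_normB _ _))// (_ : 2 = 1 + 1)// lerD.
  rewrite -mulr_sumr ler_wpM2l//; apply: le_trans Fsum.
  by rewrite big_nat_recr//= lerDl.
have := term 0%N isT; have := term m (leqnn m).
move: h1 h2 h3; rewrite !ler_norml.
set a1 := \int[P]_w f _; set a2 := \int[P]_w step_function _ _ _ _.
set a3 := \int[P']_w f _; set a4 := \int[P']_w step_function _ _ _ _.
move=> /andP[? ?] /andP[? ?] /andP[? ?] /andP[? ?] /andP[? ?].
apply/andP; split; lra.
Unshelve. all: by end_near. Qed.

End helly_bray.

(** * The Cauchy kernel and Levy's continuity theorem *)

Lemma continuous_mulrl (R : realType) (c : R) : continuous ( *%R c).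
Proof. by move=> x; apply: cvgM; [exact: cvg_cst|exact: cvg_id]. Qed.

Section cauchy_kernel.
Context (R : realType).
Implicit Types x y t : R.

(** The derivative of [atan], and the Cauchy density up to the factor [1 / pi]. *)
Definition cauchy_kernel x : R := (1 + x ^+ 2)^-1.

Lemma onePsqr_gt0 x : 0 < 1 + x ^+ 2.
Proof. by rewrite ltr_pwDl// sqr_ge0. Qed.

Lemma cauchy_kernel_ge0 x : 0 <= cauchy_kernel x.
Proof. by rewrite invr_ge0 ltW// onePsqr_gt0. Qed.

Lemma cauchy_kernel_le1 x : cauchy_kernel x <= 1.
Proof. by rewrite invf_le1 ?onePsqr_gt0// lerDl sqr_ge0. Qed.

Lemma cauchy_kernel_lipschitz x y :
  `|cauchy_kernel x - cauchy_kernel y| <= `|x - y|.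
Proof.
have x0 := onePsqr_gt0 x; have y0 := onePsqr_gt0 y.
have -> : cauchy_kernel x - cauchy_kernel y =
    (y - x) * ((x + y) / ((1 + x ^+ 2) * (1 + y ^+ 2))).
  by rewrite /cauchy_kernel; field; rewrite !gt_eqF.
rewrite normrM distrC -[leRHS]mulr1 ler_wpM2l// ler_norml.
rewrite ler_pdivlMr ?mulr_gt0// ler_pdivrMr ?mulr_gt0//.
(* The squares of [x + 1/2] and [x - 1/2] give [|x| <= x^2 + 1/4], and likewise for [y]; hence
   [|x + y|] is at most the product of the two denominators. *)
have := sqr_ge0 (x * y); have := sqr_ge0 (x + 2^-1); have := sqr_ge0 (y + 2^-1).
have := sqr_ge0 (x - 2^-1); have := sqr_ge0 (y - 2^-1).
by rewrite !expr2 => *; apply/andP; split; lra.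
Qed.

Lemma measurable_cauchy_kernel : measurable_fun setT cauchy_kernel.
Proof.
apply: continuous_measurable_fun; apply: (@lipschitz_continuous _ _ 1) => // x y.
by rewrite mul1r; exact: cauchy_kernel_lipschitz.
Qed.

(** The antiderivative in [t] of [exp (- t) (1 + cos (t x))]: it tends to 0 at infinity and equals
    [- (1 + cauchy_kernel x)] at 0. *)
Let prim x t := - expR (- t) * (1 - (x * sin (t * x) - cos (t * x)) * cauchy_kernel x).

Lemma is_derive_exponential_cos x t :
  is_derive t 1 (prim x) (expR (- t) * (1 + cos (t * x))).
Proof.
apply: is_derive_eq; rewrite /GRing.scale/= /cauchy_kernel.
have x0 := onePsqr_gt0 x.
field; by rewrite gt_eqF.
Qed.

Lemma cvgy_exponential_cos x : prim x t @[t --> +oo] --> 0.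
Proof.
apply: (@squeeze_cvgr _ _ _ _ (fun t => - (expR (- t) * (1 + (`|x| + 1))))
                             (fun t => expR (- t) * (1 + (`|x| + 1)))).
- near=> t; rewrite -ler_norml /prim normrM normrN (ger0_norm (expR_ge0 _)).
  rewrite (ler_wpM2l (expR_ge0 _))// (le_trans (ler_normB _ _))// normr1 lerD2l.
  rewrite normrM (ger0_norm (cauchy_kernel_ge0 _)).
  apply: (@le_trans _ _ ((`|x| + 1) * 1)); last by rewrite mulr1.
  apply: ler_pM => //; [exact: cauchy_kernel_ge0| |exact: cauchy_kernel_le1].
  rewrite (le_trans (ler_normB _ _))// lerD ?cos_max// normrM.
  by rewrite ler_piMr// sin_max.
- by rewrite -oppr0; apply: cvgN; rewrite -[X in _ --> X](mul0r (1 + (`|x| + 1)));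
    apply: cvgMr_tmp; exact: cvgr_expR.
- by rewrite -[X in _ --> X](mul0r (1 + (`|x| + 1))); apply: cvgMr_tmp; exact: cvgr_expR.
Unshelve. all: by end_near. Qed.

Lemma measurable_exponential_cos x :
  measurable_fun setT (fun t => exponential_pdf 1 t * (1 + cos (t * x))).
Proof.
apply: measurable_funM; first exact: measurable_exponential_pdf.
apply: measurable_funD => //.
have -> : (fun t => cos (t * x)) = cos \o ( *%R x) by apply/funext => t /=; rewrite mulrC.
apply: measurableT_comp; apply: continuous_measurable_fun;
  [exact: continuous_cos|exact: continuous_mulrl].
Qed.

(** This sign is the purpose of the summand 1: it makes Tonelli's theorem available. *)
Lemma exponential_cos_ge0 x t : 0 <= exponential_pdf 1 t * (1 + cos (t * x)).
Proof.
have := cos_max (t * x); rewrite ler_norml => /andP[h _].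
by apply: mulr_ge0; [exact: exponential_pdf_ge0|rewrite -lerBlDl sub0r].
Qed.

Lemma integral_exponential_cos x :
  (\int[lebesgue_measure]_t (exponential_pdf 1 t * (1 + cos (t * x)))%:E =
   (1 + cauchy_kernel x)%:E)%E.
Proof.
rewrite -(setUv `[0, +oo[%classic) ge0_integral_setU//=; last 4 first.
  exact: measurableC.
  by rewrite setUv; apply/measurable_EFinP; exact: measurable_exponential_cos.
  by move=> t _; rewrite lee_fin exponential_cos_ge0.
  exact/disj_setPCl.
rewrite [X in (_ + X)%E]integral0_eq ?adde0; last first.
  by move=> t t0; rewrite /exponential_pdf patchE ifF ?mul0r// memNset.
have cc : continuous (fun t => expR (- t) * (1 + cos (t * x))).
  move=> t; apply: cvgM.
    by apply: continuous_comp; [exact: opp_continuous|exact: continuous_expR].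
  apply: cvgD; first exact: cvg_cst.
  apply: continuous_comp; last exact: continuous_cos.
  by apply: cvgM; [exact: cvg_id|exact: cvg_cst].
have E t : t \in `[0, +oo[%classic ->
    exponential_pdf 1 t * (1 + cos (t * x)) = expR (- t) * (1 + cos (t * x)).
  rewrite inE/= in_itv/= andbT => t0.
  by rewrite exponential_pdfE// mul1r mulN1r.
under eq_integral => t t0 do rewrite (E t t0).
rewrite (@ge0_continuous_FTC2y _ _ (prim x) _ 0)//.
- rewrite /prim oppr0 expR0 mul0r sin0 cos0 mulr0 sub0r -EFinB; congr EFin; lra.
- exact: continuous_subspaceT.
- exact: cvgy_exponential_cos.
- apply/cvg_at_right_filter/differentiable_continuous/derivable1_diffP.
  have ? := is_derive_exponential_cos x 0; exact: ex_derive.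
- move=> t _; rewrite derive1E.
  have ? := is_derive_exponential_cos x t; by rewrite derive_val.
Qed.

End cauchy_kernel.

Lemma EFin_Rintegral d (T : measurableType d) (R : realType)
    (mu : {measure set T -> \bar R}) (f : T -> R) :
  mu.-integrable setT (EFin \o f) ->
  (\int[mu]_w (f w)%:E = (\int[mu]_w f w)%R%:E)%E.
Proof. by move=> intf; rewrite /Rintegral fineK//; exact: integrable_fin_num. Qed.

Section cauchy_kernel_expectation.
Context d (T : measurableType d) (R : realType) (P : probability T R).
Variable Z : {mfun T >-> R}.

Lemma measurable_cos_mfun (t : R) : measurable_fun setT (fun w => cos (t * Z w)).
Proof.
apply: (measurableT_comp (f := cos)).
  by apply: continuous_measurable_fun; exact: continuous_cos.
exact: measurable_funM.
Qed.

Lemma measurable_sin_mfun (t : R) : measurable_fun setT (fun w => sin (t * Z w)).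
Proof.
apply: (measurableT_comp (f := sin)).
  by apply: continuous_measurable_fun; exact: continuous_sin.
exact: measurable_funM.
Qed.

Lemma integrable_cos_mfun (t : R) :
  P.-integrable setT (EFin \o (fun w => cos (t * Z w))).
Proof.
by apply: (bounded_integrable 1) => [|w]; [exact: measurable_cos_mfun|exact: cos_max].
Qed.

Lemma integrable_sin_mfun (t : R) :
  P.-integrable setT (EFin \o (fun w => sin (t * Z w))).
Proof.
by apply: (bounded_integrable 1) => [|w]; [exact: measurable_sin_mfun|exact: sin_max].
Qed.

Local Notation f :=
  (fun z : T * R => (exponential_pdf 1 z.2 * (1 + cos (z.2 * Z z.1)))%:E).

Let mf : measurable_fun setT f.
Proof.
apply/measurable_EFinP; apply: measurable_funM.
  apply: measurableT_comp; last exact: measurable_snd.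
  exact: measurable_exponential_pdf.
apply: measurable_funD => //.
apply: (measurableT_comp (f := cos)).
  by apply: continuous_measurable_fun; exact: continuous_cos.
by apply: measurable_funM => //; exact: measurableT_comp.
Qed.

Let f0 z : (0 <= f z)%E.
Proof. by rewrite lee_fin exponential_cos_ge0. Qed.

Lemma integral_exponential_cos_mfun (t : R) :
  (\int[P]_w f (w, t) =
   (exponential_pdf 1 t * (1 + (\int[P]_w cos (t * Z w))%R))%:E)%E.
Proof.
have i1 : P.-integrable setT (EFin \o (fun w => 1 + cos (t * Z w))).
  apply: (bounded_integrable (1 + 1)) => [|w].
    by apply: measurable_funD => //; exact: measurable_cos_mfun.
  by rewrite (le_trans (ler_normD _ _))// normr1 lerD2l cos_max.
have i2 : P.-integrable setT (EFin \o (fun w => exponential_pdf 1 t * (1 + cos (t * Z w)))).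
  have := integrableZl measurableT (exponential_pdf 1 t) i1.
  by apply: eq_integrable => // w _ /=; rewrite -EFinM.
rewrite /= EFin_Rintegral// RintegralZl// RintegralD//.
- by rewrite Rintegral_prob_cst.
- by apply: (bounded_integrable 1) => // w; rewrite normr1.
- exact: integrable_cos_mfun.
Qed.

Lemma measurable_exponential_cos_mfun : measurable_fun setT (fun t =>
  (exponential_pdf 1 t * (1 + (\int[P]_w cos (t * Z w))%R))%:E : \bar R).
Proof.
under eq_fun do rewrite -integral_exponential_cos_mfun.
by apply: (measurable_fun_fubini_tonelli_G (m1 := P) f); [exact: mf|exact: f0].
Qed.

Lemma integrable_cauchy_kernel_mfun :
  P.-integrable setT (EFin \o (fun w => cauchy_kernel (Z w))).
Proof.
apply: (bounded_integrable 1) => [|w].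
  by apply: measurableT_comp => //; exact: measurable_cauchy_kernel.
by rewrite ger0_norm ?cauchy_kernel_ge0// cauchy_kernel_le1.
Qed.

(** By Tonelli, the mean of the kernel depends on [Z] only through the real part of its
    characteristic function. *)
Lemma expectation_cauchy_kernel :
  ((1 + (\int[P]_w cauchy_kernel (Z w))%R)%:E =
   \int[lebesgue_measure]_t
     (exponential_pdf 1 t * (1 + (\int[P]_w cos (t * Z w))%R))%:E)%E.
Proof.
under eq_integral do rewrite -integral_exponential_cos_mfun.
rewrite -(fubini_tonelli (m1 := P) (m2 := lebesgue_measure) f)//=.
under eq_integral do rewrite integral_exponential_cos.
have i1 : P.-integrable setT (EFin \o (fun _ : T => 1 : R)).
  by apply: (bounded_integrable 1) => // w; rewrite normr1.
have ik := integrable_cauchy_kernel_mfun.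
rewrite EFin_Rintegral; first by rewrite RintegralD// Rintegral_prob_cst.
by have := integrableD measurableT i1 ik; apply: eq_integrable.
Qed.

End cauchy_kernel_expectation.

Section cauchy_kernel_convergence.
Context d d' (T : measurableType d) (T' : measurableType d') (R : realType).
Variables (P : probability T R) (P' : probability T' R).
Variables (Z : nat -> {mfun T >-> R}) (Y : {mfun T' >-> R}).
Hypothesis cos_cvg : forall t,
  \int[P]_w cos (t * Z n w) @[n --> \oo] --> \int[P']_w cos (t * Y w).

(** Dominated convergence in the variable [t], with twice the exponential density as majorant, so
    that pointwise convergence of the real parts is enough. *)
Lemma cvg_cauchy_kernel : \int[P]_w cauchy_kernel (Z n w) @[n --> \oo] -->
  \int[P']_w cauchy_kernel (Y w).
Proof.
pose g t := (2%:E * (exponential_pdf 1 t)%:E : \bar R)%E.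
have ig : lebesgue_measure.-integrable setT g.
  by apply: integrableZl => //; exact: integrable_exponential_pdf.
have ae1 : {ae lebesgue_measure, forall t : R, setT t ->
    (exponential_pdf 1 t * (1 + (\int[P]_w cos (t * Z n w))%R))%:E @[n --> \oo] -->
    (exponential_pdf 1 t * (1 + (\int[P']_w cos (t * Y w))%R))%:E}.
  apply: aeW => t _; apply: cvg_EFin; first exact: nearW.
  by apply: cvgMl_tmp; apply: cvgD; [exact: cvg_cst|exact: cos_cvg].
have ae2 : {ae lebesgue_measure, forall (t : R) n, setT t ->
    (`|(exponential_pdf 1 t * (1 + (\int[P]_w cos (t * Z n w))%R))%:E| <= g t)%E}.
  apply: aeW => t n _; rewrite /g -EFinM lee_fin normrM mulrC.
  have pdf0 := exponential_pdf_ge0 (@ler01 R) t.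
  rewrite (ger0_norm pdf0) (ler_wpM2r pdf0)//.
  rewrite (le_trans (ler_normD _ _))// normr1 (_ : 2 = 1 + 1)// lerD2l.
  apply: normr_Rintegral_le; first exact: measurable_cos_mfun.
  by move=> w; exact: cos_max.
have [| |_ _] := @dominated_convergence _ _ R lebesgue_measure setT measurableT
  (fun n t => (exponential_pdf 1 t * (1 + (\int[P]_w cos (t * Z n w))%R))%:E)
  (fun t => (exponential_pdf 1 t * (1 + (\int[P']_w cos (t * Y w))%R))%:E) g
  _ _ ae1 ig ae2.
- by move=> n; exact: measurable_exponential_cos_mfun.
- exact: measurable_exponential_cos_mfun.
rewrite /= -expectation_cauchy_kernel.
under eq_fun do rewrite -expectation_cauchy_kernel.
move=> /fine_cvg/= h.
apply/cvgrPdist_le => e e0; move/cvgrPdist_le : h => /(_ e e0).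
by apply: filterS => n /=; rewrite opprD addrACA subrr add0r.
Qed.

End cauchy_kernel_convergence.

Section affine_mfun.
Context d (T : measurableType d) (R : realType).

Definition affine_mfun (c b : R) (X : {mfun T >-> R}) : T -> R := fun w => c * X w + b.

Lemma measurable_affine_mfun c b X : measurable_fun setT (affine_mfun c b X).
Proof. by apply: measurable_funD => //; apply: measurable_funM. Qed.

HB.instance Definition _ c b X :=
  isMeasurableFun.Build _ _ _ _ (affine_mfun c b X) (measurable_affine_mfun c b X).

End affine_mfun.

(** * Smoothed indicators of intervals as limits of sums of Cauchy kernels *)

Section atan_window.
Context (R : realType).
Implicit Types x u : R.

(** By the mean value theorem the increment is [dl] times the kernel at a point within [dl] of [u],
    and the kernel is 1-Lipschitz. *)
Lemma atan_increment u (dl : R) : 0 <= dl ->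
  `|atan u - atan (u - dl) - dl * cauchy_kernel u| <= dl ^+ 2.
Proof.
move=> dl0; have [| |v] := @MVT_segment R atan (@cauchy_kernel R) (u - dl) u.
- by rewrite lerBlDr lerDl.
- by apply: continuous_subspaceT => y; exact: continuous_atan.
rewrite in_itv/= => /andP[uv vu] ->.
rewrite (_ : u - (u - dl) = dl); last by ring.
rewrite [_ * dl]mulrC -mulrBr normrM ger0_norm// expr2 ler_wpM2l//.
rewrite (le_trans (cauchy_kernel_lipschitz _ _))// ler0_norm ?subr_le0//.
by rewrite opprB lerBlDr addrC -lerBlDr.
Qed.

(** A Riemann sum with left nodes for the integral of [c * cauchy_kernel (c * (x - y))] over [y]
    between [a] and [a + N h], which is a difference of two values of [atan]. The argument is
    written in the shape of [affine_mfun]. *)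
Definition cauchy_sum (c a h : R) (N : nat) x : R :=
  \sum_(0 <= j < N) c * h * cauchy_kernel (c * x + - (c * (a + j%:R * h))).

(** The window telescopes into [N] increments, each with error [(c * h) ^+ 2]. The bound is uniform
    in [x], so it survives taking expectations. *)
Lemma atan_window_cauchy_sum (c a h : R) (N : nat) x : 0 <= c * h ->
  `|atan (c * (x - a)) - atan (c * (x - (a + N%:R * h))) - cauchy_sum c a h N x|
  <= N%:R * (c * h) ^+ 2.
Proof.
move=> ch0; elim: N => [|N IH].
  by rewrite mul0r addr0 subrr /cauchy_sum big_geq// subrr normr0 mul0r.
have := atan_increment (c * (x - (a + N%:R * h))) ch0.
have -> : c * (x - (a + N%:R * h)) - c * h = c * (x - (a + N.+1%:R * h)).
  by rewrite -natr1; ring.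
rewrite /cauchy_sum big_nat_recr//= -/(cauchy_sum c a h N x).
move=> h1.
have -> : N.+1%:R * (c * h) ^+ 2 = N%:R * (c * h) ^+ 2 + (c * h) ^+ 2.
  by rewrite -natr1 mulrDl mul1r.
rewrite -[c * x - c * (a + N%:R * h)]mulrBr.
apply: le_trans (lerD IH h1); apply: le_trans (ler_normD _ _).
by rewrite le_eqVlt; apply/orP; left; apply/eqP; congr `|_|; ring.
Qed.

End atan_window.

Section window_expectation.
Context d (T : measurableType d) (R : realType) (P : probability T R).
Variables (X : {mfun T >-> R}) (c : R).

Lemma integrable_cauchy_sum (a h : R) N :
  P.-integrable setT (EFin \o (fun w => cauchy_sum c a h N (X w))).
Proof.
elim: N => [|N IH].
  apply: (bounded_integrable 0) => [|w]; last by rewrite /cauchy_sum big_geq// normr0.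
  rewrite (_ : (fun w => _) = cst 0) //.
  by apply/funext => w; rewrite /cauchy_sum big_geq.
have := integrableD measurableT IH (integrableZl measurableT (c * h)
   (integrable_cauchy_kernel_mfun P (affine_mfun c (- (c * (a + N%:R * h))) X))).
by apply: eq_integrable => // w _ /=; rewrite /cauchy_sum big_nat_recr//= EFinD EFinM.
Qed.

Lemma Rintegral_cauchy_sum (a h : R) N : \int[P]_w cauchy_sum c a h N (X w) =
  \sum_(0 <= j < N) c * h *
    \int[P]_w cauchy_kernel (affine_mfun c (- (c * (a + j%:R * h))) X w).
Proof.
elim: N => [|N IH].
  rewrite big_geq// -[RHS](Rintegral_prob_cst P); apply: eq_Rintegral => w _.
  by rewrite /cauchy_sum big_geq.
rewrite big_nat_recr//= -IH -RintegralZl//; last exact: integrable_cauchy_kernel_mfun.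
rewrite -RintegralD//; last 2 first.
- exact: integrable_cauchy_sum.
- have := integrableZl measurableT (c * h)
    (integrable_cauchy_kernel_mfun P (affine_mfun c (- (c * (a + N%:R * h))) X)).
  by apply: eq_integrable => // w _ /=; rewrite EFinM.
by apply: eq_Rintegral => w _; rewrite /cauchy_sum big_nat_recr.
Qed.

Lemma measurable_atan_window (a b : R) :
  measurable_fun setT (fun w => atan (c * (X w - a)) - atan (c * (X w - b))).
Proof.
have m y : measurable_fun setT (fun w => atan (c * (X w - y))).
  apply: (measurableT_comp (f := atan)).
    by apply: continuous_measurable_fun => z; exact: continuous_atan.
  by apply: measurable_funM => //; apply: measurable_funB.
exact: measurable_funB.
Qed.

Lemma integrable_atan_window (a b : R) : P.-integrable setT
  (EFin \o (fun w => atan (c * (X w - a)) - atan (c * (X w - b)))).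
Proof.
apply: (bounded_integrable pi); first exact: measurable_atan_window.
move=> w; set u := atan _; set v := atan _.
have := atan_gtNpi2 (c * (X w - a)); have := atan_ltpi2 (c * (X w - a)).
have := atan_gtNpi2 (c * (X w - b)); have := atan_ltpi2 (c * (X w - b)).
rewrite -/u -/v => *; rewrite ler_norml; apply/andP; split; lra.
Qed.

End window_expectation.

Section levy.
Context d d' (T : measurableType d) (T' : measurableType d') (R : realType).
Variables (P : probability T R) (P' : probability T' R).
Variables (X : nat -> {mfun T >-> R}) (Y : {mfun T' >-> R}).
Hypothesis cos_cvg : forall t,
  \int[P]_w cos (t * X n w) @[n --> \oo] --> \int[P']_w cos (t * Y w).
Hypothesis sin_cvg : forall t,
  \int[P]_w sin (t * X n w) @[n --> \oo] --> \int[P']_w sin (t * Y w).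

(** The shift [b] mixes the real and imaginary parts of the characteristic function; for this reason
    convergence of the sines is needed as well. *)
Lemma Rintegral_cos_affine d0 (T0 : measurableType d0) (P0 : probability T0 R)
    (Z : {mfun T0 >-> R}) (c b t : R) :
  \int[P0]_w cos (t * affine_mfun c b Z w) =
  cos (t * b) * \int[P0]_w cos (t * c * Z w) -
  sin (t * b) * \int[P0]_w sin (t * c * Z w).
Proof.
have i1 : P0.-integrable setT (EFin \o (fun w => cos (t * b) * cos (t * c * Z w))).
  have := integrableZl measurableT (cos (t * b)) (integrable_cos_mfun P0 Z (t * c)).
  by apply: eq_integrable => // w _ /=; rewrite EFinM.
have i2 : P0.-integrable setT (EFin \o (fun w => sin (t * b) * sin (t * c * Z w))).
  have := integrableZl measurableT (sin (t * b)) (integrable_sin_mfun P0 Z (t * c)).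
  by apply: eq_integrable => // w _ /=; rewrite EFinM.
rewrite -RintegralZl//; last exact: integrable_cos_mfun.
rewrite -RintegralZl//; last exact: integrable_sin_mfun.
rewrite -RintegralB//; apply: eq_Rintegral => w _.
by rewrite /affine_mfun mulrDr mulrA cosD [cos _ * _]mulrC [sin _ * _]mulrC.
Qed.

Lemma cvg_cauchy_affine (c b : R) :
  \int[P]_w cauchy_kernel (affine_mfun c b (X n) w) @[n --> \oo] -->
  \int[P']_w cauchy_kernel (affine_mfun c b Y w).
Proof.
apply: (@cvg_cauchy_kernel _ _ _ _ _ P P' (fun n => affine_mfun c b (X n))
  (affine_mfun c b Y)) => t.
rewrite Rintegral_cos_affine; under eq_fun do rewrite Rintegral_cos_affine.
by apply: cvgB; apply: cvgMl_tmp; [exact: cos_cvg|exact: sin_cvg].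
Qed.

Lemma cvg_atan_window (c a b : R) : 0 < c -> a < b ->
  \int[P]_w (atan (c * (X n w - a)) - atan (c * (X n w - b))) @[n --> \oo] -->
  \int[P']_w (atan (c * (Y w - a)) - atan (c * (Y w - b))).
Proof.
move=> c0 ab; apply/cvgrPdist_le => e e0.
pose B := (c * (b - a)) ^+ 2.
have B0 : 0 <= B by exact: sqr_ge0.
(* With [N] cells of width [(b - a) / N] the total Riemann error is [B / N], which this choice makes
   at most [e / 3]. *)
pose N := (Num.bound (3 * B / e)).+1.
have NB : N%:R * (B / N%:R ^+ 2) <= e / 3.
  have N0 : (0 : R) < N%:R by rewrite ltr0n.
  have h : 3 * B / e <= N%:R.
    have h0 : 0 <= 3 * B / e by apply: divr_ge0; [exact: mulr_ge0|exact: ltW].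
    by apply: (le_trans (ltW (archi_boundP h0))); rewrite ler_nat.
  move: h; rewrite ler_pdivrMr// => h.
  rewrite (_ : N%:R * _ = B / N%:R); last by field; rewrite gt_eqF.
  rewrite ler_pdivrMr//; lra.
pose h := (b - a) / N%:R.
have N0 : (N%:R : R) != 0 by rewrite pnatr_eq0.
have ch0 : 0 <= c * h by rewrite mulr_ge0// ?ltW// divr_gt0// ?subr_gt0// ltr0n.
have bE : a + N%:R * h = b by rewrite /h; field.
have approx d0 (T0 : measurableType d0) (P0 : probability T0 R) (Z : {mfun T0 >-> R}) :
    `|\int[P0]_w (atan (c * (Z w - a)) - atan (c * (Z w - b))) -
      \int[P0]_w cauchy_sum c a h N (Z w)| <= e / 3.
  rewrite -[leRHS](Rintegral_prob_cst P0).
  apply: normr_RintegralB_le.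
  - exact: integrable_atan_window.
  - exact: integrable_cauchy_sum.
  - by apply: (bounded_integrable `|e / 3|).
  move=> w; apply: le_trans NB.
  have := atan_window_cauchy_sum a N (Z w) ch0; rewrite bE => /le_trans; apply.
  rewrite le_eqVlt; apply/orP; left; apply/eqP; congr (_ * _).
  by rewrite /B /h; field.
have e30 : 0 < e / 3 by rewrite divr_gt0.
have : \int[P]_w cauchy_sum c a h N (X n w) @[n --> \oo] -->
       \int[P']_w cauchy_sum c a h N (Y w).
  rewrite Rintegral_cauchy_sum; under eq_fun do rewrite Rintegral_cauchy_sum.
  apply: cvg_big => // [|j _]; first exact: add_continuous.
  apply: cvgMl_tmp; exact: cvg_cauchy_affine.
move=> /cvgrPdist_le/(_ _ e30); apply: filterS => n h3.
have h1 := approx _ _ P (X n); have h2 := approx _ _ P' Y.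
move: h1 h2 h3; rewrite !ler_norml => /andP[? ?] /andP[? ?] /andP[? ?].
apply/andP; split; lra.
Qed.

End levy.

Section atan_window_indicator.
Context (R : realType).
Implicit Types (a b c dl e x : R).
Local Notation window a b c x := (atan (c * (x - a)) - atan (c * (x - b))).

Let ler_atan (u v : R) : u <= v -> atan u <= atan v.
Proof. by rewrite le_eqVlt => /predU1P[->//|/lt_atan/ltW]. Qed.

(** The window rises from 0 to about [pi] and falls back, with transitions of width about [dl] when
    [c * dl] is large: [e] measures how far [atan (c * dl)] is from its limit [pi / 2]. *)
Lemma atan_window_le_right a b c dl e x : 0 < c -> 0 <= e -> pi / 2 - atan (c * dl) <= e ->
  window a b c x <= pi * (x <= b + dl)%R%:R + e.
Proof.
move=> c0 e0 cdl.
have h1 := atan_ltpi2 (c * (x - a)); have h2 := atan_gtNpi2 (c * (x - b)).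
have [xb|xb] := leP x (b + dl) => /=.
  rewrite mulr1; lra.
have : atan (c * dl) <= atan (c * (x - b)).
  by apply: ler_atan; rewrite ler_pM2l// lerBrDl ltW.
lra.
Qed.

Lemma atan_window_le_left a b c dl e x : 0 < c -> 0 < dl -> 0 <= e -> pi / 2 - atan (c * dl) <= e ->
  window a b c x <= pi * (1 - (x <= a - 2 * dl)%R%:R) + e.
Proof.
move=> c0 dl0 e0 cdl.
have h1 := atan_ltpi2 (c * (x - a)); have h2 := atan_gtNpi2 (c * (x - b)).
have [xa|xa] := leP x (a - 2 * dl) => /=; last first.
  rewrite subr0 mulr1; lra.
have : atan (c * (x - a)) <= atan (- (c * dl)).
  by apply: ler_atan; rewrite -mulrN ler_pM2l//; lra.
rewrite atanN subrr mulr0; lra.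
Qed.

(** The lower bound is nontrivial only for [x] between [a + dl] and [b - dl], where both values of
    [atan] are within [e] of their limits; elsewhere non-negativity of the window suffices. *)
Lemma atan_window_ge a b c dl e x : a < b -> 0 < c -> 0 <= e ->
  pi / 2 - atan (c * dl) <= e ->
  pi * ((x <= b - dl)%R%:R - (x <= a + dl)%R%:R) - 2 * e <= window a b c x.
Proof.
move=> ab c0 e0 cdl.
have w0 : 0 <= window a b c x.
  by rewrite subr_ge0; apply: ler_atan; rewrite ler_pM2l// lerB// ltW.
have pi0 := pi_gt0 R.
have [xb|xb] := leP x (b - dl); have [xa|xa] := leP x (a + dl) => /=; try lra.
have : atan (c * dl) <= atan (c * (x - a)).
  by apply: ler_atan; rewrite ler_pM2l//; lra.
have : atan (c * (x - b)) <= atan (- (c * dl)).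
  by apply: ler_atan; rewrite -mulrN ler_pM2l//; lra.
rewrite atanN subr0 mulr1; lra.
Qed.

End atan_window_indicator.

Section window_cdf.
Context d (T : measurableType d) (R : realType) (P : probability T R).
Variable Z : {mfun T >-> R}.
Local Notation F := (fun x => fine (cdf (P := P) Z x)).

Lemma integrable_two_indicators (p q r s t : R) : P.-integrable setT
  (EFin \o (fun w => p * (Z w <= s)%R%:R + q * (Z w <= t)%R%:R + r)).
Proof.
apply: (bounded_integrable (`|p| + `|q| + `|r|)) => [|w].
  by apply: measurable_funD => //; apply: measurable_funD; apply: measurable_funM => //;
    exact: measurable_mfun_le.
apply: (le_trans (ler_normD _ _)); rewrite lerD2r.
apply: (le_trans (ler_normD _ _)); apply: lerD; rewrite normrM;
  by case: (Z w <= _) => /=; rewrite ?normr1 ?normr0 ?mulr1 ?mulr0.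
Qed.

Lemma Rintegral_two_indicators (p q r s t : R) :
  \int[P]_w (p * (Z w <= s)%R%:R + q * (Z w <= t)%R%:R + r) = p * F s + q * F t + r.
Proof.
have i1 u v : P.-integrable setT (EFin \o (fun w => u * (Z w <= v)%R%:R)).
  have := integrable_two_indicators u 0 0 v 0; apply: eq_integrable => // w _ /=.
  by rewrite mul0r !addr0.
rewrite RintegralD//; last 2 first.
- have := integrable_two_indicators p q 0 s t.
  by apply: eq_integrable => // w _ /=; rewrite addr0.
- exact: (bounded_integrable `|r|).
rewrite RintegralD// !RintegralZl ?Rintegral_indicator_cdf ?Rintegral_prob_cst//;
  exact: integrable_mfun_le.
Qed.

Variables (a b c dl e : R).
Hypothesis ab : a < b.
Hypothesis c0 : 0 < c.
Hypothesis dl0 : 0 < dl.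
Hypothesis e0 : 0 <= e.
Hypothesis cdl : pi / 2 - atan (c * dl) <= e.
Local Notation window x := (atan (c * (x - a)) - atan (c * (x - b))).

Lemma Rintegral_window_le_right : \int[P]_w window (Z w) <= pi * F (b + dl) + e.
Proof.
have := Rintegral_two_indicators pi 0 e (b + dl) 0.
rewrite mul0r addr0 => <-; apply: le_Rintegral => //.
- exact: integrable_atan_window.
- exact: integrable_two_indicators.
- by move=> w _; rewrite mul0r addr0; exact: atan_window_le_right.
Qed.

Lemma Rintegral_window_le_left :
  \int[P]_w window (Z w) <= pi * (1 - F (a - 2 * dl)) + e.
Proof.
have -> : pi * (1 - F (a - 2 * dl)) + e = - pi * F (a - 2 * dl) + 0 * F 0 + (pi + e).
  by ring.
rewrite -Rintegral_two_indicators; apply: le_Rintegral => //.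
- exact: integrable_atan_window.
- exact: integrable_two_indicators.
- move=> w _; apply: (le_trans (atan_window_le_left _ _ _ c0 dl0 e0 cdl)).
  by rewrite le_eqVlt; apply/orP; left; apply/eqP; ring.
Qed.

Lemma Rintegral_window_ge :
  pi * (F (b - dl) - F (a + dl)) - 2 * e <= \int[P]_w window (Z w).
Proof.
have -> : pi * (F (b - dl) - F (a + dl)) - 2 * e =
    pi * F (b - dl) + - pi * F (a + dl) + - (2 * e) by ring.
rewrite -Rintegral_two_indicators; apply: le_Rintegral => //.
- exact: integrable_two_indicators.
- exact: integrable_atan_window.
- move=> w _; apply: le_trans (atan_window_ge _ ab c0 e0 cdl).
  by rewrite le_eqVlt; apply/orP; left; apply/eqP; ring.
Qed.

End window_cdf.

Section levy_theorem.
Context d d' (T : measurableType d) (T' : measurableType d') (R : realType).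
Variables (P : probability T R) (P' : probability T' R).
Variables (X : nat -> {mfun T >-> R}) (Y : {mfun T' >-> R}).
Hypothesis cos_cvg : forall t,
  \int[P]_w cos (t * X n w) @[n --> \oo] --> \int[P']_w cos (t * Y w).
Hypothesis sin_cvg : forall t,
  \int[P]_w sin (t * X n w) @[n --> \oo] --> \int[P']_w sin (t * Y w).
Local Notation Fn := (fun n x => fine (cdf (P := P) (X n) x)).
Local Notation F := (fun x => fine (cdf (P := P') Y x)).

(* Each right-hand side dominates the probability that [X n] is in the window,
   so that no tightness is needed. *)
Lemma window_cdf_bounds (a b dl e : R) : a < b -> 0 < dl -> 0 < e ->
  \forall n \near \oo,
    F (b - dl) - F (a + dl) - e <= Fn n (b + dl) /\
    F (b - dl) - F (a + dl) - e <= 1 - Fn n (a - 2 * dl).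
Proof.
move=> ab dl0 e0.
have pi0 := pi_gt0 R.
(* Four errors of this size add up to [pi * e]: two from the lower bound for [Y], one from the
   convergence, one from the upper bound for [X n]. *)
have e10 : 0 < pi * e / 4 by rewrite divr_gt0// mulr_gt0.
have [c [c0 cdl]] : exists c : R, 0 < c /\ pi / 2 - atan (c * dl) <= pi * e / 4.
  have : \forall x \near +oo, pi / 2 - atan x <= pi * e / 4.
    have /cvgrPdist_le/(_ _ e10) := @cvgy_atan R.
    by apply: filterS => x; apply: le_trans; exact: ler_norm.
  move=> /(filterI (nbhs_pinfty_gt (num_real 0)))/filter_ex[x [/= x0 hx]].
  by exists (x / dl); rewrite divr_gt0// divfK// gt_eqF.
have /cvgrPdist_le/(_ _ e10) := cvg_atan_window cos_cvg sin_cvg c0 ab.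
apply: filterS => n; rewrite ler_norml => /andP[_ h].
have h1 := Rintegral_window_ge P' Y ab c0 (ltW e10) cdl.
have h2 := Rintegral_window_le_right P (X n) a b c0 (ltW e10) cdl.
have h3 := Rintegral_window_le_left P (X n) a b c0 dl0 (ltW e10) cdl.
split; rewrite -(ler_pM2l pi0); lra.
Qed.

(** A window ending at [x - dl] bounds [Fn n x] from below, and a window starting at [x + 2 * dl]
    bounds [1 - Fn n x] from below. Their outer ends lie where [Y] has almost no mass left, and
    continuity of [F] at [x] closes the gap. *)
Theorem levy_continuity : cvg_in_distribution P P' X Y.
Proof.
move=> x cx; apply/fine_cvgP; split; first by apply: nearW => n; exact: fin_num_measure.
apply/cvgrPdist_le => e e0.
have e40 : 0 < e / 4 by rewrite divr_gt0.
have [dl dl0 hdl] : exists2 dl : R, 0 < dl &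
    forall y, `|x - y| <= 3 * dl -> `|F x - F y| <= e / 4.
  move/cvgrPdist_le : cx => /(_ _ e40)/nbhs_ballP[r /= r0 hr].
  exists (r / 4); first by rewrite divr_gt0.
  move=> y xy; apply: hr; rewrite /ball/=; apply: (le_lt_trans xy); lra.
have h1 : `|F x - F (x - 2 * dl)| <= e / 4.
  by apply: hdl; rewrite opprB addrC subrK ger0_norm; lra.
have h2 : `|F x - F (x + 3 * dl)| <= e / 4.
  by apply: hdl; rewrite opprD addrA subrr sub0r normrN ger0_norm; lra.
have [u hu] := fine_cdf_small P' Y e40; have [v hv] := fine_cdf_large P' Y e40.
have ndF := fine_cdf_nondecreasing P' Y.
(* The extra [2 * dl] keeps [a1 + dl] below [u] and [b2 - dl] above [v], so that both tails of [Y]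
   are at most [e / 4]; the minimum and the maximum keep the windows non-degenerate. *)
pose a1 := Num.min u (x - dl) - 2 * dl; pose b2 := Num.max v (x + 2 * dl) + 2 * dl.
have a1b : a1 < x - dl.
  have : Num.min u (x - dl) <= x - dl by rewrite ge_min lexx orbT.
  rewrite /a1; lra.
have ab2 : x + 2 * dl < b2.
  have : x + 2 * dl <= Num.max v (x + 2 * dl) by rewrite le_max lexx orbT.
  rewrite /b2; lra.
have Fa1 : F (a1 + dl) <= e / 4.
  apply: le_trans hu; apply: ndF; rewrite /a1.
  have : Num.min u (x - dl) <= u by rewrite ge_min lexx.
  lra.
have Fb2 : 1 - F (b2 - dl) <= e / 4.
  apply: le_trans hv; rewrite lerB//; apply: ndF; rewrite /b2.
  have : v <= Num.max v (x + 2 * dl) by rewrite le_max lexx.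
  lra.
near=> n.
have [k1 _] : F (x - dl - dl) - F (a1 + dl) - e / 4 <= Fn n (x - dl + dl) /\ 
    F (x - dl - dl) - F (a1 + dl) - e / 4 <= 1 - Fn n (a1 - 2 * dl).
  by near: n; exact: window_cdf_bounds.
have [_ k2] : F (b2 - dl) - F (x + 2 * dl + dl) - e / 4 <= Fn n (b2 + dl) /\
    F (b2 - dl) - F (x + 2 * dl + dl) - e / 4 <= 1 - Fn n (x + 2 * dl - 2 * dl).
  by near: n; exact: window_cdf_bounds.
rewrite subrK in k1; rewrite addrK in k2.
rewrite (_ : x - dl - dl = x - 2 * dl) in k1; last by ring.
rewrite (_ : x + 2 * dl + dl = x + 3 * dl) in k2; last by ring.
move: h1 h2; rewrite !ler_norml => /andP[? ?] /andP[? ?]; rewrite /=.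
apply/andP; split; lra.
Unshelve. all: by end_near. Qed.

End levy_theorem.

(** * Independence *)

Section independent_pair.
Context d d1 d2 (T : measurableType d) (E1 : measurableType d1)
  (E2 : measurableType d2) (R : realType) (P : probability T R).
Variables (U : {mfun T >-> E1}) (V : {mfun T >-> E2}).
Hypothesis UV : forall A B, measurable A -> measurable B ->
  P (U @^-1` A `&` V @^-1` B) = (P (U @^-1` A) * P (V @^-1` B))%E.

Let pair_UV : T -> E1 * E2 := fun w => (U w, V w).

Let mpair : measurable_fun setT pair_UV.
Proof. by apply/measurable_fun_pairP; split; exact: measurable_funP. Qed.

HB.instance Definition _ := isMeasurableFun.Build _ _ _ _ pair_UV mpair.

(** Independence says that the law of the pair agrees with the product of the laws on rectangles,
    hence everywhere; Tonelli then integrates one variable at a time. *)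
Lemma ge0_integral_independent (g : E1 * E2 -> \bar R) :
  measurable_fun setT g -> (forall z, 0 <= g z)%E ->
  (\int[P]_w g (U w, V w) = \int[P]_w1 \int[P]_w2 g (U w1, V w2))%E.
Proof.
move=> mg g0.
pose m1 : probability E1 R := distribution P U.
pose m2 : probability E2 R := distribution P V.
pose m12 : probability (E1 * E2)%type R := distribution P pair_UV.
transitivity (\int[m12]_z g z)%E.
  by rewrite ge0_integral_distribution.
transitivity (\int[m1 \x m2]_z g z)%E.
  apply: eq_measure_integral => A mA _; apply/esym.
  by apply: (product_measure_unique (m' := m12)) => // B C mB mC; exact: UV.
rewrite fubini_tonelli1// ge0_integral_distribution.
- apply: eq_integral => w _ /=; rewrite /fubini_F.
  rewrite ge0_integral_distribution//.
  exact: measurableT_comp.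
- exact: measurable_fun_fubini_tonelli_F.
- by move=> y; exact: integral_ge0.
Qed.

Lemma Rintegral_independent (g : E1 * E2 -> R) (M : R) :
  measurable_fun setT g -> (forall z, `|g z| <= M) ->
  measurable_fun setT (fun w1 => \int[P]_w2 g (U w1, V w2)) /\
  \int[P]_w g (U w, V w) = \int[P]_w1 \int[P]_w2 g (U w1, V w2).
Proof.
move=> mg gM.
(* Adding the bound [M] reduces to a non-negative function; the constant is removed from both sides
   at the end. *)
have gM0 z : (0 <= (g z + M)%:E)%E.
  by rewrite lee_fin -lerBlDr sub0r; have := gM z; rewrite ler_norml => /andP[].
have mgM : measurable_fun setT (fun z => (g z + M)%:E).
  by apply/measurable_EFinP; apply: measurable_funD.
have mgU w1 : measurable_fun setT (fun w2 => g (U w1, V w2)).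
  apply: measurableT_comp => //.
  by apply/measurable_fun_pairP; split => /=; [exact: measurable_cst|exact: measurable_funP].
have iU w1 : P.-integrable setT (EFin \o (fun w2 => g (U w1, V w2))).
  by apply: (bounded_integrable M) => // w; exact: gM.
have ic : P.-integrable setT (EFin \o (fun _ : T => M)).
  exact: (bounded_integrable `|M|).
have inner w1 : (\int[P]_w2 (g (U w1, V w2) + M)%:E =
    (\int[P]_w2 g (U w1, V w2) + M)%R%:E)%E.
  rewrite EFin_Rintegral; first by rewrite RintegralD// Rintegral_prob_cst.
  by have := integrableD measurableT (iU w1) ic; apply: eq_integrable.
have mI : measurable_fun setT (fun w1 => \int[P]_w2 g (U w1, V w2)).
  pose m2 : probability E2 R := distribution P V.
  have h : measurable_fun setT (fun x => \int[m2]_y (g (x, y) + M)%:E)%E.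
    exact: (measurable_fun_fubini_tonelli_F (m2 := m2) (fun z => (g z + M)%:E)).
  have : measurable_fun setT (fun w1 => (\int[P]_w2 g (U w1, V w2) + M)%:E).
    under eq_fun do rewrite -inner.
    have : measurable_fun setT (fun w1 => \int[m2]_y (g (U w1, y) + M)%:E)%E.
      exact: (measurableT_comp h).
    apply: eq_measurable_fun => w1 _.
    rewrite ge0_integral_distribution//.
    by apply/measurable_EFinP; apply: measurable_funD => //; exact: measurableT_comp.
  move=> /measurable_EFinP h1.
  rewrite (_ : (fun _ => _) = (fun w1 => \int[P]_w2 g (U w1, V w2) + M - M)).
    exact: measurable_funB.
  by apply/funext => w1; rewrite addrK.
split=> //.
have iO : P.-integrable setT (EFin \o (fun w1 => \int[P]_w2 g (U w1, V w2))).
  by apply: (bounded_integrable M) => // w; apply: normr_Rintegral_le.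
have ig : P.-integrable setT (EFin \o (fun w => g (U w, V w))).
  by apply: (bounded_integrable M) => [|w]; [exact: measurableT_comp|exact: gM].
have := ge0_integral_independent mgM gM0.
rewrite EFin_Rintegral; last first.
  by have := integrableD measurableT ig ic; apply: eq_integrable.
under [X in _ = X]eq_integral do rewrite inner.
rewrite EFin_Rintegral; last first.
  by have := integrableD measurableT iO ic; apply: eq_integrable.
move=> [/eqP]; rewrite RintegralD// RintegralD//.
by rewrite Rintegral_prob_cst => /eqP/addIr.
Qed.

End independent_pair.

Section family_sigma_algebra.
Context d (T : measurableType d) (R : realType) (P : probability T R).

(* The sample space with the sigma-algebra generated by a family: the identity
   into it plays the role of the (possibly infinite) random vector [X]. *)
Definition family_type (I : Type) (D : set I) (X : I -> {mfun T >-> R}) :=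
  g_sigma_algebraType (\bigcup_(i in D) preimage_set_system setT (X i) measurable).

Context (I : Type) (D : set I) (X : I -> {mfun T >-> R}).
Local Notation TX := (family_type D X).

HB.instance Definition _ := Measurable.on TX.

Definition family_id : T -> TX := id.

Lemma measurable_family_id : measurable_fun setT family_id.
Proof.
move=> _ B mB; rewrite setTI.
apply: (smallest_sub (@sigma_algebra_measurable _ T) _ mB).
by move=> _ [i Di [C mC <-]]; rewrite setTI; exact: measurable_funPTI.
Qed.

HB.instance Definition _ :=
  isMeasurableFun.Build _ _ _ _ family_id measurable_family_id.

Lemma measurable_family i : D i -> measurable_fun setT (X i : TX -> R).
Proof.
move=> Di _ B mB; apply: sub_sigma_algebra; exists i => //.
by exists B.
Qed.

End family_sigma_algebra.

(** Measurability is required only inside the range: for the sigma-algebra of a subfamily the other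
    terms need not be measurable. They are replaced by 0. *)
Lemma measurable_sum_nat d (E : measurableType d) (R : realType)
    (f : nat -> E -> R) (m n : nat) :
  (forall k, (m <= k < n)%N -> measurable_fun setT (f k)) ->
  measurable_fun setT (fun x => \sum_(m <= k < n) f k x).
Proof.
move=> mf.
pose h k x := if (m <= k < n)%N then f k x else 0.
have -> : (fun x => \sum_(m <= k < n) f k x) = (fun x => \sum_(m <= k < n) h k x).
  by apply/funext => x; apply: eq_big_nat => k kmn; rewrite /h kmn.
apply: measurable_sum => k; rewrite /h.
by have [/mf|_] := boolP (m <= k < n)%N; last exact: measurable_cst.
Qed.

Section mutual_independence.
Context d (T : measurableType d) (R : realType) (P : probability T R).
Variable xi : nat -> {mfun T >-> R}.
Hypothesis xi_indep : mutually_independent P [set k | (1 <= k)%N] xi.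

Local Notation prefix n := [set k | (1 <= k <= n)%N].

(** The pi-system on which mutual independence can be read off directly. *)
Let cylinder n : set (set T) :=
  [set A | exists B : nat -> set R, (forall i, measurable (B i)) /\
    A = \bigcap_(i in prefix n) xi i @^-1` B i].

Let cylinder_measurable n : cylinder n `<=` measurable.
Proof.
move=> A [B [mB ->]]; apply: bigcap_measurableType => k _; exact: measurable_funPTI.
Qed.

Lemma probability_cylinder n (B : nat -> set R) : (forall i, measurable (B i)) ->
  P (\bigcap_(i in prefix n) xi i @^-1` B i) =
  (\prod_(i <- iota 1 n) P (xi i @^-1` B i))%E.
Proof.
move=> mB; pose J := [fset k in iota 1 n]%fset.
have J1 : [set` J] = prefix n.
  by apply/seteqP; split=> k /=; rewrite !inE/= mem_iota add1n ltnS.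
rewrite -J1 xi_indep//; last by rewrite J1 => k /= /andP[].
apply: perm_big; apply: uniq_perm; [exact: fset_uniq|exact: iota_uniq|].
by move=> k; rewrite in_fset/=.
Qed.

(** For [C] the event on [xi n.+1], the finite measures [P (A & C)] and [P A * P C] of [A] agree on
    cylinders, which are stable under intersection and generate the sigma-algebra of the first [n]
    variables. *)
Lemma mutually_independent_prefix n (A : set T) (B : set R) :
  family_sigma_algebra (P := P) (prefix n) xi A -> measurable B ->
  P (A `&` xi n.+1 @^-1` B) = (P A * P (xi n.+1 @^-1` B))%E.
Proof.
move=> sA mB.
have mC : measurable (xi n.+1 @^-1` B) by exact: measurable_funPTI.
set C := xi n.+1 @^-1` B in mC *.
have rC : 0 <= fine (P C) by rewrite fine_ge0.
pose m1 := mrestr P mC; pose m2 := mscale (NngNum rC) P.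
have Ccyl : cylinder n setT.
  exists (fun=> setT); split=> //; apply/seteqP; split=> // x _ i _ //.
have m2E D : m2 D = (P D * P C)%E by rewrite /m2 /mscale/= fineK ?fin_num_measure// muleC.
have sA' : <<s cylinder n >> A.
  move: A sA; apply: smallest_sub; first exact: smallest_sigma_algebra.
  move=> _ [i /= hi [D mD <-]]; apply: sub_sigma_algebra; rewrite setTI.
  exists (fun k => if k == i then D else setT); split; first by move=> k; case: ifP.
  apply/seteqP; split=> [x xD k _|x]; first by rewrite /preimage/=; case: eqP => [->|].
  by move=> /(_ i hi); rewrite /preimage/= eqxx.
rewrite -[RHS]m2E -[LHS]/(m1 A).
apply: (g_sigma_algebra_measure_unique (cylinder n) _ (fun=> setT)) => //.
- by rewrite bigcup_const//; exists 0%N.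
- move=> _ _ [D [mD ->]] [D' [mD' ->]]; exists (fun i => D i `&` D' i).
  split=> [i|]; first exact: measurableI.
  by rewrite -bigcapI.
- move=> _ [D [mD ->]]; rewrite [RHS]m2E /m1 /mrestr.
  (* A cylinder on the first [n] variables, intersected with the event on [xi n.+1], is a cylinder
     on [n.+1] variables. *)
  pose D' k := if k == n.+1 then B else D k.
  have mD' k : measurable (D' k) by rewrite /D'; case: ifP.
  transitivity (P (\bigcap_(i in prefix n.+1) xi i @^-1` D' i)).
    congr (P _); apply/seteqP; split=> x.
      move=> [h1 h2] k /= /andP[k1]; rewrite leq_eqVlt /D' /preimage/=.
      by case: eqP => [->//|_ /=]; rewrite ltnS => kn; apply: h1; rewrite /= k1.
    move=> h; split; last by have := h n.+1; rewrite /D' /preimage/= eqxx; apply.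
    move=> k /= /andP[k1 kn]; have := h k; rewrite /D' /preimage/= k1 (leqW kn).
    by rewrite ifF; [apply|apply/negP => /eqP kE; rewrite kE ltnn in kn].
  rewrite !probability_cylinder//.
  have -> : iota 1 n.+1 = iota 1 n ++ [:: n.+1].
    by rewrite -[in LHS](addn1 n) iotaD add1n.
  rewrite big_cat/= big_seq1.
  congr (_ * _)%E; last by rewrite /D' eqxx.
  rewrite !big_seq; apply: eq_bigr => k; rewrite mem_iota add1n ltnS => /andP[_ kn].
  by rewrite /D' ifF//; apply/negP => /eqP kE; rewrite kE ltnn in kn.
- move=> k; rewrite /m1 /mrestr (le_lt_trans (probability_le1 _ _)) ?ltry//.
  exact: measurableI.
Qed.

End mutual_independence.

Section char_fun.
Context d (T : measurableType d) (R : realType) (P : probability T R).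

Lemma char_funE (X : {mfun T >-> R}) t : char_fun P X t =
  (\int[P]_w cos (t * X w) +i* \int[P]_w sin (t * X w))%C.
Proof. by rewrite /char_fun unlock. Qed.

Variable xi : nat -> {mfun T >-> R}.
Hypothesis xi_indep : mutually_independent P [set k | (1 <= k)%N] xi.

(** Induction on [n]: the partial sum is a function of the first [n] variables, hence independent of
    [xi n.+1], and the addition formulas for cos and sin are multiplication of complex numbers. *)
Lemma char_fun_lin_comb (s : nat -> R) n :
  (\int[P]_w cos (\sum_(1 <= k < n.+1) s k * xi k w) +i*
   \int[P]_w sin (\sum_(1 <= k < n.+1) s k * xi k w))%C =
  \prod_(1 <= k < n.+1) char_fun P (xi k) (s k).
Proof.
elim: n => [|n IH].
  rewrite big_geq//.
  have -> : \int[P]_w cos (\sum_(1 <= k < 1) s k * xi k w) = 1.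
    by rewrite -[RHS](Rintegral_prob_cst P); apply: eq_Rintegral => w _;
      rewrite big_geq// cos0.
  have -> // : \int[P]_w sin (\sum_(1 <= k < 1) s k * xi k w) = 0.
  by rewrite -[RHS](Rintegral_prob_cst P); apply: eq_Rintegral => w _;
    rewrite big_geq// sin0.
pose D := [set k | (1 <= k <= n)%N].
(* [E] is the sample space with the smaller sigma-algebra: measurability of the partial sum on [E]
   records that it depends on the first [n] variables only. *)
pose E : measurableType _ := family_type D xi.
pose S : E -> R := fun w => \sum_(1 <= k < n.+1) s k * xi k w.
have mS : measurable_fun setT S.
  apply: measurable_sum_nat => k kn; apply: measurable_funM => //.
  exact: (@measurable_family _ _ _ _ D xi k kn).
have mS' : measurable_fun setT (S : T -> R).
  by apply: measurable_sum => k; apply: measurable_funM.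
have indep (A : set E) (B : set R) : measurable A -> measurable B ->
    P (family_id D xi @^-1` A `&` xi n.+1 @^-1` B) =
    (P (family_id D xi @^-1` A) * P (xi n.+1 @^-1` B))%E.
  by move=> mA mB; apply: mutually_independent_prefix.
have mg (h : R -> R) : continuous h ->
    measurable_fun setT (fun z : E * R => h (S z.1 + s n.+1 * z.2)).
  move=> ch; apply: (measurableT_comp (f := h)); first exact: continuous_measurable_fun.
  apply: measurable_funD; first exact: measurableT_comp.
  exact: measurable_funM.
have ih (h : R -> R) : continuous h -> (forall x, `|h x| <= 1) ->
    P.-integrable setT (EFin \o (fun w => h (S w))).
  move=> ch h1; apply: (bounded_integrable 1) => // .
  by apply: (measurableT_comp (f := h)) => //; exact: continuous_measurable_fun.
have iz (h : R -> R) r : continuous h -> (forall x, `|h x| <= 1) ->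
    P.-integrable setT (EFin \o (fun w => h (S w) * r)).
  move=> ch h1; have := integrableZr measurableT r (ih h ch h1).
  by apply: eq_integrable.
have ccos := @continuous_cos R; have csin := @continuous_sin R.
have [_ hc] := Rintegral_independent indep (mg _ ccos) (fun z => cos_max _).
have [_ hs] := Rintegral_independent indep (mg _ csin) (fun z => sin_max _).
have izl (h : R -> R) r : continuous h -> (forall x, `|h x| <= 1) ->
    P.-integrable setT (EFin \o (fun w => r * h (s n.+1 * xi n.+1 w))).
  move=> ch h1; apply: (bounded_integrable `|r|).
    apply: measurable_funM => //; apply: (measurableT_comp (f := h)).
      exact: continuous_measurable_fun.
    exact: measurable_funM.
  by move=> w; rewrite normrM ler_piMr.
pose c := \int[P]_w cos (s n.+1 * xi n.+1 w).
pose c' := \int[P]_w sin (s n.+1 * xi n.+1 w).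
have icos := integrable_cos_mfun P (xi n.+1) (s n.+1).
have isin := integrable_sin_mfun P (xi n.+1) (s n.+1).
rewrite big_nat_recr//= -IH char_funE -/c -/c'.
have -> : \int[P]_w cos (\sum_(1 <= k < n.+2) s k * xi k w) =
    \int[P]_w cos (S w) * c - \int[P]_w sin (S w) * c'.
  transitivity (\int[P]_w cos (S w + s n.+1 * xi n.+1 w)).
    by apply: eq_Rintegral => w _; rewrite big_nat_recr.
  rewrite hc -RintegralZr//; last exact: ih (@cos_max R).
  rewrite -RintegralZr//; last exact: ih (@sin_max R).
  rewrite -RintegralB//; [|exact: iz (@cos_max R)|exact: iz (@sin_max R)].
  apply: eq_Rintegral => w _; rewrite -RintegralZl// -RintegralZl//.
  rewrite -RintegralB//; [|exact: izl (@cos_max R)|exact: izl (@sin_max R)].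
  by apply: eq_Rintegral => v _; rewrite cosD.
have -> : \int[P]_w sin (\sum_(1 <= k < n.+2) s k * xi k w) =
    \int[P]_w cos (S w) * c' + \int[P]_w sin (S w) * c.
  transitivity (\int[P]_w sin (S w + s n.+1 * xi n.+1 w)).
    by apply: eq_Rintegral => w _; rewrite big_nat_recr.
  rewrite hs -RintegralZr//; last exact: ih (@cos_max R).
  rewrite -RintegralZr//; last exact: ih (@sin_max R).
  rewrite -RintegralD//; [|exact: iz (@cos_max R)|exact: iz (@sin_max R)].
  apply: eq_Rintegral => w _; rewrite -RintegralZl// -RintegralZl//.
  rewrite -RintegralD//; [|exact: izl (@sin_max R)|exact: izl (@cos_max R)].
  by apply: eq_Rintegral => v _; rewrite sinD addrC.
by [].
Qed.

End char_fun.

(** * Complex and real inequalities *)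

Section normc_lemmas.
Context (R : realType).
Implicit Types (z : R[i]) (x y : R).
Import ComplexField.Normc.

Lemma normc_Re_le z : `|Re z| <= normc z.
Proof. by case: z => a b /=; rewrite -sqrtr_sqr ler_wsqrtr// lerDl sqr_ge0. Qed.

Lemma normc_Im_le z : `|Im z| <= normc z.
Proof. by case: z => a b /=; rewrite -sqrtr_sqr ler_wsqrtr// lerDr sqr_ge0. Qed.

Lemma normc_real x : normc x%:C%C = `|x|.
Proof. by rewrite /= expr0n/= addr0 sqrtr_sqr. Qed.

Lemma normc_ge0 z : 0 <= normc z.
Proof. by case: z => a b; exact: sqrtr_ge0. Qed.

Lemma normc_le_ReIm z : normc z <= `|Re z| + `|Im z|.
Proof.
case: z => a b /=; rewrite -[leRHS]ger0_norm ?addr_ge0// -sqrtr_sqr ler_wsqrtr//.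
by rewrite sqrrD !real_normK ?num_real// addrAC lerDl mulrn_wge0// mulr_ge0.
Qed.

Lemma normcX z n : normc (z ^+ n) = normc z ^+ n.
Proof. by elim: n => [|n IH]; rewrite ?expr0 ?normc1// !exprS normcM IH. Qed.

Lemma normcB_sym z z' : normc (z - z') = normc (z' - z).
Proof. by rewrite -normcN opprB. Qed.

Lemma normcB_le z z' : `|normc z - normc z'| <= normc (z - z').
Proof.
have h u v : normc u - normc v <= normc (u - v).
  by rewrite lerBlDr; apply: le_trans (le_normcD _ _); rewrite subrK.
by rewrite ler_norml lerNl opprB h normcB_sym h.
Qed.

Lemma normc_prod_le1 (z : nat -> R[i]) (s : seq nat) :
  (forall k, normc (z k) <= 1) -> normc (\prod_(k <- s) z k) <= 1.
Proof.
move=> z1; elim: s => [|k s IH]; first by rewrite big_nil normc1.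
by rewrite big_cons normcM -[leRHS]mulr1 ler_pM ?normc_ge0.
Qed.

(** Exchange the factors one at a time: all the others stay in the unit disc. *)
Lemma normc_prodB_le (z z' : nat -> R[i]) m n :
  (forall k, normc (z k) <= 1) -> (forall k, normc (z' k) <= 1) ->
  normc (\prod_(m <= k < n) z k - \prod_(m <= k < n) z' k) <=
  \sum_(m <= k < n) normc (z k - z' k).
Proof.
move=> z1 z'1; rewrite /index_iota; elim: (iota _ _) => [|k s IH].
  by rewrite !big_nil subrr normc0.
rewrite !big_cons.
have -> : z k * \prod_(j <- s) z j - z' k * \prod_(j <- s) z' j =
   (z k - z' k) * \prod_(j <- s) z j +
   z' k * (\prod_(j <- s) z j - \prod_(j <- s) z' j) by ring.
apply: (le_trans (le_normcD _ _)); rewrite !normcM lerD//.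
  by rewrite ler_piMr ?normc_ge0// normc_prod_le1.
by apply: le_trans IH; rewrite ler_piMl ?normc_ge0.
Qed.

Lemma complex_prod_real (x : nat -> R) m n :
  \prod_(m <= k < n) (x k)%:C%C = (\prod_(m <= k < n) x k)%:C%C.
Proof. by rewrite rmorph_prod. Qed.

End normc_lemmas.

Section elementary.
Context (R : realType).
Implicit Types x y : R.

Lemma derivable_lipschitz1 (f df : R -> R) :
  (forall x, is_derive x 1 f (df x)) -> (forall x, `|df x| <= 1) ->
  forall x y, `|f x - f y| <= `|x - y|.
Proof.
move=> fdf df1 x y.
wlog xy : x y / x <= y.
  move=> H; have [|/ltW] := leP x y; first exact: H.
  by move=> /H; rewrite distrC [leRHS]distrC.
have [|c _ h] := @MVT_segment R f df x y xy (fun z _ => fdf z).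
  apply: continuous_subspaceT => z.
  apply/differentiable_continuous/derivable1_diffP.
  have ? := fdf z; exact: ex_derive.
by rewrite distrC h normrM distrC ler_piMl.
Qed.

Lemma cos_lipschitz x y : `|cos x - cos y| <= `|x - y|.
Proof.
apply: derivable_lipschitz1 (fun x => - sin x) _ _ _ _ => z.
by rewrite normrN sin_max.
Qed.

Lemma sin_lipschitz x y : `|sin x - sin y| <= `|x - y|.
Proof. by apply: derivable_lipschitz1 (@cos R) _ (@cos_max R) _ _. Qed.

Lemma atan_lipschitz x y : `|atan x - atan y| <= `|x - y|.
Proof.
apply: derivable_lipschitz1 (@cauchy_kernel R) _ _ _ _ => z.
by rewrite ger0_norm ?cauchy_kernel_ge0// cauchy_kernel_le1.
Qed.

Lemma ln_sub_le x y : 0 < x -> 0 < y -> ln x - ln y <= (x - y) / y.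
Proof.
move=> x0 y0; rewrite -ln_div ?posrE//.
have -> : x / y = 1 + (x - y) / y by field; rewrite gt_eqF.
apply: le_ln1Dx; have xy0 : 0 < x / y by rewrite divr_gt0.
have -> : (x - y) / y = x / y - 1 by field; rewrite gt_eqF.
lra.
Qed.

(** Since [exp y >= 1 + y], the value [exp (- y)] lies between [1 - y] and [1 / (1 + y)], and the
    latter is at most [1 - y + y^2]. *)
Lemma expRN_approx y : 0 <= y -> `|expR (- y) - 1 + y| <= y ^+ 2.
Proof.
move=> y0; have h := expR_ge1Dx (- y).
rewrite ger0_norm; last lra.
have := expR_ge1Dx y; have e0 := expR_gt0 y.
rewrite expRN => h1.
have : (expR y)^-1 <= (1 + y)^-1 by rewrite lef_pV2 ?posrE//; lra.
have : (1 + y)^-1 <= 1 - y + y ^+ 2.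
  rewrite invf_ple ?posrE//; [|lra|nra].
  rewrite -div1r ler_pdivrMr; last nra.
  have : 0 <= y ^+ 3 by rewrite exprn_ge0.
  rewrite !exprS expr0; nra.
lra.
Qed.

Lemma expRN_le1 y : 0 <= y -> expR (- y) <= 1.
Proof. by move=> y0; rewrite -expR0 ler_expR oppr_le0. Qed.

Lemma de_moivre (r t : R) n :
  ((r * cos t +i* (r * sin t)) ^+ n)%C =
  (r ^+ n * cos (n%:R * t) +i* (r ^+ n * sin (n%:R * t)))%C.
Proof.
elim: n => [|n IH]; first by rewrite !expr0 mul0r cos0 sin0 mulr0 mulr1.
rewrite exprS IH -natr1 mulrDl mul1r cosD sinD.
by apply/eqP; rewrite eq_complex /= !exprS; apply/andP; split; apply/eqP; ring.
Qed.

(** In the right half-plane the argument in []-pi/2, pi/2[] is the arctangent of the slope. *)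
Lemma polar_form (x y : R) : 0 < x ->
  let r := ComplexField.Normc.normc (x +i* y)%C in let t := atan (y / x) in
  (x +i* y)%C = (r * cos t +i* (r * sin t))%C.
Proof.
move=> x0 r t.
have ct : cos t = (Num.sqrt (1 + (y / x) ^+ 2))^-1 by exact: cos_atan.
have s0 : 0 < Num.sqrt (1 + (y / x) ^+ 2) by rewrite sqrtr_gt0 onePsqr_gt0.
have rE : r = x * Num.sqrt (1 + (y / x) ^+ 2).
  rewrite /r/= -{2}(ger0_norm (ltW x0)) -sqrtr_sqr -sqrtrM ?sqr_ge0//.
  by congr Num.sqrt; field; rewrite gt_eqF.
have st : sin t = y / x * cos t.
  have := atanK (y / x); rewrite /tan -/t => <-.
  by rewrite divfK// ct invr_eq0 gt_eqF.
apply/eqP; rewrite eq_complex /= st ct rE.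
by apply/andP; split; apply/eqP; field; rewrite ?gt_eqF.
Qed.

End elementary.

(* Recovers [n (1 - z)] from [z ^+ n]; the hypothesis on the argument selects the
   branch of the [n]-th root. *)
Lemma rate_of_power (R : realType) (z : R[i]) (n : nat) (r dl e : R) :
  let th := atan (Im z / Re z) in
  0 < Re z -> normc z <= 1 -> `|n%:R * th| < pi / 2 -> (0 < n)%N ->
  0 < dl -> e <= dl -> 2 * dl <= expR (- r) ->
  normc (z ^+ n - (expR (- r))%:C%C) <= e ->
  normc (n%:R%:C%C * (1 - z) - r%:C%C) <= 3 * (e / dl) + dl^-1 ^+ 2 / n%:R.
Proof.
case: z => c s th c0 rho1 thpi n0 dl0 edl dlr he.
rewrite [Re _]/= in c0.
pose rho := normc (c +i* s)%C; rewrite -/rho in rho1.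
have e0 : 0 <= e by apply: le_trans he; exact: normc_ge0.
have nR0 : (0 : R) < n%:R by rewrite ltr0n.
have zE : (c +i* s)%C = (rho * cos th +i* (rho * sin th))%C by exact: polar_form.
have [cE sE] : c = rho * cos th /\ s = rho * sin th by case: zE.
have rho0 : 0 < rho.
  by apply: lt_le_trans (normc_Re_le _); rewrite /= gtr0_norm.
pose p := rho ^+ n.
have p0 : 0 < p by rewrite exprn_gt0.
have znE : ((c +i* s) ^+ n)%C = (p * cos (n%:R * th) +i* (p * sin (n%:R * th)))%C.
  by rewrite {1}zE de_moivre.
have hA : `|p * cos (n%:R * th) - expR (- r)| <= e.
  by apply: le_trans he; have := normc_Re_le ((c +i* s)%C ^+ n - (expR (- r))%:C%C);
    rewrite znE.
have hB : `|p * sin (n%:R * th)| <= e.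
  by apply: le_trans he; have := normc_Im_le ((c +i* s)%C ^+ n - (expR (- r))%:C%C);
    rewrite znE /= subr0.
have hp : `|p - expR (- r)| <= e.
  apply: le_trans he; have := normcB_le ((c +i* s)%C ^+ n) (expR (- r))%:C%C.
  by rewrite normcX normc_real (ger0_norm (expR_ge0 _)).
have pdl : dl <= p by move: hp; rewrite ler_norml => /andP[? ?]; lra.
have Adl : dl <= p * cos (n%:R * th) by move: hA; rewrite ler_norml => /andP[? ?]; lra.
have A0 : 0 < p * cos (n%:R * th) by exact: lt_le_trans Adl.
have cn0 : 0 < cos (n%:R * th) by move: A0; rewrite pmulr_rgt0.
pose E := e / dl.
have E0 : 0 <= E by rewrite divr_ge0// ltW.
have divle u v : u <= e -> dl <= v -> u / v <= E.
  move=> ue dv; have v0 := lt_le_trans dl0 dv.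
  apply: (@le_trans _ _ (e / v)); first by rewrite ler_wpM2r// invr_ge0 ltW.
  by rewrite ler_wpM2l// lef_pV2 ?posrE.
(* Since [n * th] lies in []-pi/2, pi/2[], [atan] recovers it from its tangent, the quotient of the
   imaginary part of [z ^+ n] (at most [e]) by the real part (at least [dl]). *)
have nth : n%:R * `|th| <= E.
  rewrite -[n%:R]gtr0_norm// -normrM.
  have tE : n%:R * th = atan (tan (n%:R * th)).
    rewrite tanK// in_itv/=; by move: thpi; rewrite ltr_norml.
  rewrite tE; have := atan_lipschitz (tan (n%:R * th)) 0.
  rewrite atan0 !subr0 => /le_trans; apply.
  have -> : tan (n%:R * th) = (p * sin (n%:R * th)) / (p * cos (n%:R * th)).
    by rewrite /tan; field; rewrite !gt_eqF.
  rewrite normrM normfV (gtr0_norm A0) divle//.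
have hs : n%:R * `|s| <= E.
  apply: le_trans nth; rewrite ler_wpM2l// sE normrM (gtr0_norm rho0).
  have := sin_lipschitz th 0; rewrite sin0 !subr0 => h.
  by apply: (le_trans _ h); rewrite ler_piMl.
have hc : n%:R * (rho * `|1 - cos th|) <= E.
  apply: le_trans nth; rewrite ler_wpM2l//.
  have := cos_lipschitz 0 th; rewrite cos0 sub0r normrN => h.
  by apply: (le_trans _ h); rewrite ler_piMl.
(* The passage from [rho ^+ n] to [n (1 - rho)] goes through the logarithm:
   [l (1 - l) <= 1 - rho <= l], where [n * l = - ln (rho ^+ n)] stays below [1 / dl]. *)
pose l := - ln rho.
have l0 : 0 <= l by rewrite oppr_ge0 ln_le0.
have l1 : 1 - rho <= l.
  by rewrite /l; have := ln_sub_le rho0 ltr01; rewrite ln1 divr1; lra.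
have l2 : l * rho <= 1 - rho.
  by rewrite -ler_pdivlMr// /l; have := ln_sub_le ltr01 rho0; rewrite ln1; lra.
have l3 : l * (1 - l) <= 1 - rho.
  by apply: le_trans l2; rewrite ler_wpM2l//; lra.
pose L := n%:R * l.
have LE : L = - ln p by rewrite /L /l /p lnXn// mulr_natl mulNrn.
have L0 : 0 <= L by rewrite mulr_ge0// ltW.
have Ldl : L <= dl^-1.
  have := ln_sub_le ltr01 p0; rewrite ln1 sub0r -LE => /le_trans; apply.
  rewrite -[leRHS]mul1r; apply: (@le_trans _ _ (1 / p)).
    by rewrite ler_wpM2r ?invr_ge0 ?(ltW p0)// gerBl ltW.
  by rewrite !mul1r lef_pV2 ?posrE.
have Lr : `|L - r| <= E.
  have q0 := expR_gt0 (- r).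
  have h1 := ln_sub_le p0 q0; have h2 := ln_sub_le q0 p0.
  rewrite expRK in h1 h2.
  have dq : dl <= expR (- r) by lra.
  move: hp; rewrite ler_norml => /andP[hp1 hp2].
  have i1 : (p - expR (- r)) / expR (- r) <= E by apply: divle => //.
  have i2 : (expR (- r) - p) / p <= E by apply: divle => //; lra.
  rewrite LE ler_norml; apply/andP; split; lra.
have Ln : `|n%:R * (1 - rho) - L| <= dl^-1 ^+ 2 / n%:R.
  have k1 : n%:R * (1 - rho) <= L by rewrite ler_wpM2l.
  have k2 : n%:R * (l * (1 - l)) <= n%:R * (1 - rho) by rewrite ler_wpM2l.
  have k3 : n%:R * (l * (1 - l)) = L - L ^+ 2 / n%:R.
    by rewrite /L; field; rewrite gt_eqF.
  have k4 : L ^+ 2 / n%:R <= dl^-1 ^+ 2 / n%:R.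
    by rewrite ler_wpM2r ?invr_ge0// lerXn2r// nnegrE invr_ge0 ltW.
  rewrite ler_norml; apply/andP; split; lra.
(* Three errors [E] come from [L - r], from [1 - cos th] and from the imaginary part; replacing
   [n (1 - rho)] by [L] costs the remaining term. *)
apply: (le_trans (normc_le_ReIm _)).
have -> : Re (n%:R%:C%C * (1 - (c +i* s)%C) - r%:C%C) =
    (n%:R * (1 - rho) - L) + (L - r) + n%:R * (rho * (1 - cos th)).
  by rewrite /= {1}cE; ring.
have -> : Im (n%:R%:C%C * (1 - (c +i* s)%C) - r%:C%C) = - (n%:R * s).
  by rewrite /=; ring.
rewrite normrN normrM gtr0_norm//.
have h : `|n%:R * (rho * (1 - cos th))| <= E.
  by rewrite !normrM (gtr0_norm nR0) (gtr0_norm rho0).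
have := ler_normD ((n%:R * (1 - rho) - L) + (L - r)) (n%:R * (rho * (1 - cos th))).
have := ler_normD (n%:R * (1 - rho) - L) (L - r).
rewrite -/E; lra.
Qed.

(** * Scaling of a characteristic function *)

Section scaling.
Context (R : realType).
Variables (phi : R -> R[i]) (a : nat -> R) (alpha : R).
Hypothesis phi0 : phi 0 = 1.
Hypothesis phi_Re : continuous (fun u => complex.Re (phi u)).
Hypothesis phi_Im : continuous (fun u => complex.Im (phi u)).
Hypothesis phi1 : forall u, normc (phi u) <= 1.
Hypothesis a0 : forall n, (1 <= n)%N -> 0 < a n.
Hypothesis alpha0 : 0 < alpha.
Hypothesis phi_cvg : forall M e : R, 0 < e -> \forall n \near \oo,
  forall t : R, 0 <= t <= M ->
    normc (phi (t / a n) ^+ n - (expR (- (t `^ alpha)))%:C%C) <= e.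

Let rho u := normc (phi u).

Lemma rho_cvg (M e : R) : 0 < e -> \forall n \near \oo, forall t : R, 0 <= t <= M ->
  `|rho (t / a n) ^+ n - expR (- (t `^ alpha))| <= e.
Proof.
move=> e0; have := phi_cvg M e0; apply: filterS => n h t tM.
apply: le_trans (h t tM); rewrite /rho -normcX.
have := normcB_le (phi (t / a n) ^+ n) (expR (- (t `^ alpha)))%:C%C.
by rewrite normc_real (ger0_norm (expR_ge0 _)).
Qed.

(** If [rho u < 1] and [a n < K], then [rho u ^+ n], which tends to 0, would be close to
    [exp (- (u * a n)^alpha)], which is bounded below. If [rho] is 1 on the half-line, the limit
    [exp (- 1)] at [t = 1] is impossible. *)
Lemma scaling_pinfty : a @ \oo --> +oo.
Proof.
apply/cvgryPge => K.
have [[u [u0 ru]]|H] := pselect (exists u, 0 <= u /\ rho u < 1).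
  (* A third of the lower bound: approximation within [dl] leaves [rho u ^+ n >= 2 * dl], which
     fails for large [n]. *)
  pose dl := expR (- ((u * K) `^ alpha)) / 3.
  have dl0 : 0 < dl by rewrite divr_gt0// expR_gt0.
  have r0 : 0 <= rho u by exact: normc_ge0.
  have h1 : \forall n \near \oo, rho u ^+ n < 2 * dl.
    have : (fun n => rho u ^+ n) @ \oo --> 0 by apply: cvg_expr; rewrite ger0_norm.
    move=> /cvgr_lt; apply; lra.
  near=> n; rewrite leNgt; apply/negP => aK.
  have an0 : 0 < a n by apply: a0; near: n; exact: nbhs_infty_ge.
  have h3 : `|rho (u * a n / a n) ^+ n - expR (- ((u * a n) `^ alpha))| <= dl.
    have h2 : forall t : R, 0 <= t <= u * K ->
        `|rho (t / a n) ^+ n - expR (- (t `^ alpha))| <= dl.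
      by near: n; exact: rho_cvg.
    by apply: h2; rewrite mulr_ge0 ?(ltW an0)// ler_wpM2l// ltW.
  have h4 : expR (- ((u * K) `^ alpha)) <= expR (- ((u * a n) `^ alpha)).
    rewrite ler_expR lerN2; apply: ge0_ler_powR; rewrite ?nnegrE ?(ltW alpha0)//.
    - by rewrite mulr_ge0// ltW.
    - by rewrite mulr_ge0// (le_trans (ltW an0))// ltW.
    - by rewrite ler_wpM2l// ltW.
  have h5 : rho u ^+ n < 2 * dl by near: n.
  move: h3; rewrite mulfK ?gt_eqF// ler_norml => /andP[h3 _].
  have : expR (- ((u * K) `^ alpha)) = 3 * dl by rewrite /dl; field.
  lra.
have rho1 u : 0 <= u -> rho u = 1.
  move=> u0; apply/eqP; rewrite eq_le phi1 leNgt; apply/negP => ru.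
  by apply: H; exists u.
have e0 : (0 : R) < 4^-1 by rewrite invr_gt0.
near=> n; exfalso.
have an0 : 0 < a n by apply: a0; near: n; exact: nbhs_infty_ge.
have h : forall t : R, 0 <= t <= 1 -> `|rho (t / a n) ^+ n - expR (- (t `^ alpha))| <= 4^-1.
  by near: n; exact: rho_cvg.
have := h 1; rewrite lexx ler01 => /(_ isT).
rewrite rho1 ?expr1n ?powR1 ?divr_ge0 ?(ltW an0)//.
have : expR (- 1) <= (2 : R)^-1.
  by rewrite expRN lef_pV2 ?posrE ?expR_gt0//; have := expR_ge1Dx (1 : R); lra.
rewrite ler_norml => ? /andP[_ ?]; lra.
Unshelve. all: by end_near. Qed.

(** If [a n.+1] were much larger than [a n], then at the common point [1 / a n.+1] the [n]-th power
    of [rho] would be close to 1 while the [n.+1]-st is close to [exp (- 1)]; a single further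
    factor cannot cause this drop. *)
Lemma scaling_ratio_bounded :
  exists2 K : R, 0 < K & \forall n \near \oo, a n.+1 <= K * a n.
Proof.
(* Chosen so that [K^alpha = 4]: then [t^alpha <= 1/4] and the [n]-th power is at least
   [3/4 - 1/50 = 73/100]. *)
pose K : R := 4 `^ alpha^-1.
have K0 : 0 < K by rewrite powR_gt0.
have Ka : K `^ alpha = 4 by rewrite -powRrM mulVf ?gt_eqF// powRr1.
exists K => //.
have e0 : (0 : R) < 50^-1 by rewrite invr_gt0.
have near2 : \forall n \near \oo, forall s, 0 <= s <= 1 ->
    `|rho (s / a n.+1) ^+ n.+1 - expR (- (s `^ alpha))| <= 50^-1.
  by have [N _ hN] := rho_cvg 1 e0; exists N => // k /= Nk; apply: hN; exact: leqW.
near=> n; rewrite leNgt; apply/negP => aK.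
have n0 : (1 <= n)%N by near: n; exact: nbhs_infty_ge.
have an0 : 0 < a n by exact: a0.
have an1 : 0 < a n.+1 by exact: a0.
pose t := a n / a n.+1.
have t0 : 0 < t by rewrite divr_gt0.
have tK : t <= K^-1 by rewrite ler_pdivrMr// mulrC ler_pdivlMr// mulrC ltW.
have h1 : forall s, 0 <= s <= K^-1 ->
   `|rho (s / a n) ^+ n - expR (- (s `^ alpha))| <= 50^-1 by near: n; exact: rho_cvg.
have h2 : forall s, 0 <= s <= 1 ->
   `|rho (s / a n.+1) ^+ n.+1 - expR (- (s `^ alpha))| <= 50^-1.
  by near: n.
have := h2 1; rewrite lexx ler01 => /(_ isT); rewrite powR1.
have := h1 t; rewrite tK (ltW t0) => /(_ isT).
have -> : t / a n = 1 / a n.+1 by rewrite /t; field; rewrite !gt_eqF.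
set r := rho (1 / a n.+1).
have r0 : 0 <= r by exact: normc_ge0.
have r1 : r <= 1 by exact: phi1.
have ta : t `^ alpha <= 4^-1.
  have := ge0_ler_powR (ltW alpha0); move=> /(_ t K^-1); rewrite !nnegrE.
  move=> /(_ (ltW t0)); rewrite invr_ge0 (ltW K0) => /(_ isT tK).
  by rewrite -powR_inv1 ?(ltW K0)// -powRrM mulrC powRrM Ka powR_inv1.
have et : 3 / 4 <= expR (- (t `^ alpha)).
  have := expR_ge1Dx (- (t `^ alpha)); lra.
have e1 : expR (- 1) <= (2 : R)^-1.
  by rewrite expRN lef_pV2 ?posrE ?expR_gt0//; have := expR_ge1Dx (1 : R); lra.
(* Squaring dominates one more factor, as [n.+1 <= 2 * n]. The contradiction is
   [(73/100)^2 > 1/2 + 1/50]. *)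
have rr : (r ^+ n) ^+ 2 <= r ^+ n.+1.
  rewrite -exprM; apply: ler_wiXn2l => //.
  by rewrite muln2 -addnn -addn1 leq_add2l.
rewrite !ler_norml => /andP[h3 _] /andP[_ h4].
have h5 : 73 / 100 <= r ^+ n by lra.
have : (73 / 100) ^+ 2 <= (r ^+ n) ^+ 2 by rewrite lerXn2r// nnegrE; lra.
rewrite expr2; lra.
Unshelve. all: by end_near. Qed.

Lemma scaling_Re_gt0 (M : R) : \forall n \near \oo, forall t : R, 0 <= t <= M ->
  0 < Re (phi (t / a n)).
Proof.
have h : \forall u \near (0 : R), 0 < Re (phi u).
  by have /cvgr_gt := @phi_Re 0; apply; rewrite phi0.
have [r r0 hr] : exists2 r : R, 0 < r & forall u, `|u| < r -> 0 < Re (phi u).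
  move: h => /nbhs_ballP[r /= r0 hr]; exists r => // u ur; apply: hr.
  by rewrite /ball/= sub0r normrN.
near=> n => t /andP[t0 tM].
have an0 : 0 < a n by apply: a0; near: n; exact: nbhs_infty_ge.
have aM : M < r * a n.
  rewrite mulrC -ltr_pdivrMr//; near: n; move/cvgryPgt : scaling_pinfty; exact.
apply: hr; rewrite ger0_norm ?divr_ge0 ?(ltW an0)//.
by rewrite ltr_pdivrMr// (le_lt_trans tM).
Unshelve. all: by end_near. Qed.

(** An application of [rate_of_power]. Its condition on the argument holds by continuity in [s]: the
    angle [th s] starts at 0, and [cos (th s)] never vanishes. *)
Lemma scaling_rate (M e : R) : 0 < e -> \forall n \near \oo, forall t : R, 0 <= t <= M ->
  normc (n%:R%:C%C * (1 - phi (t / a n)) - (t `^ alpha)%:C%C) <= e.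
Proof.
move=> e0.
(* [2 * dl] is the least value of [exp (- t^alpha)] on [[0, M]], and [e'] makes [3 * (e' / dl)] at
   most [e / 2]. *)
pose dl := expR (- (M `^ alpha)) / 2.
have dl0 : 0 < dl by rewrite divr_gt0// expR_gt0.
pose e' := Num.min dl (dl * e / 6).
have e'0 : 0 < e' by rewrite lt_min dl0/= divr_gt0// mulr_gt0.
near=> n => t /andP[t0 tM].
have n0 : (0 < n)%N by near: n; exact: nbhs_infty_gt.
have nR0 : (0 : R) < n%:R by rewrite ltr0n.
have an0 : 0 < a n by apply: a0; near: n; exact: nbhs_infty_ge.
have hpos : forall t : R, 0 <= t <= M -> 0 < Re (phi (t / a n)).
  by near: n; exact: scaling_Re_gt0.
have hphi : forall t : R, 0 <= t <= M ->
    normc (phi (t / a n) ^+ n - (expR (- (t `^ alpha)))%:C%C) <= e'.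
  by near: n; exact: phi_cvg.
have dlt s : 0 <= s <= M -> 2 * dl <= expR (- (s `^ alpha)).
  move=> /andP[s0 sM]; rewrite /dl mulrC divfK// ler_expR lerN2.
  by apply: ge0_ler_powR; rewrite ?nnegrE ?(ltW alpha0)// (le_trans s0).
have e'dl : e' <= dl by rewrite ge_min lexx.
pose th s := n%:R * atan (Im (phi (s / a n)) / Re (phi (s / a n))).
(* If the cosine vanished, so would the real part of the [n]-th power, which is within [dl] of a
   number at least [2 * dl]. *)
have cth s : 0 <= s <= M -> cos (th s) != 0.
  move=> sM; have c0 := hpos s sM; have hd := dlt s sM.
  have := le_trans (normc_Re_le _) (hphi s sM); rewrite /th.
  case: (phi (s / a n)) c0 => x y x0; rewrite (polar_form y x0) de_moivre.
  rewrite -(polar_form y x0) /= => h; apply/eqP => c0; move: h.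
  rewrite c0 mulr0 sub0r normrN (ger0_norm (expR_ge0 _)); lra.
have th0 : th 0 = 0 by rewrite /th mul0r phi0 /= mul0r atan0 mulr0.
have thc : {within `[0, t], continuous th}.
  apply: continuous_in_subspaceT => s; rewrite inE/= in_itv/= => /andP[s0 st].
  have sM : 0 <= s <= M by rewrite s0 (le_trans st).
  have cdiv : {for s, continuous (fun x : R => x / a n)}.
    by apply: cvgM; [exact: cvg_id|exact: cvg_cst].
  apply: cvgM; first exact: cvg_cst.
  apply: continuous_comp; last exact: continuous_atan.
  apply: cvgM; first exact: (@continuous_comp _ _ _ (fun x : R => x / a n)
    (fun u => Im (phi u)) s cdiv (@phi_Im _)).
  apply: cvgV; first by rewrite gt_eqF// hpos.
  exact: (@continuous_comp _ _ _ (fun x : R => x / a n)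
    (fun u => Re (phi u)) s cdiv (@phi_Re _)).
have pi20 : 0 < (pi / 2 : R) by rewrite divr_gt0// pi_gt0.
have thpi : `|th t| < pi / 2.
  rewrite ltNge; apply/negP => hth.
  have [s st cs0] : exists2 s, s \in `[0, t] & cos (th s) = 0.
    have [tp|tn] := leP 0 (th t).
      rewrite ger0_norm// in hth.
      have [|s st hs] := @IVT R th 0 t (pi / 2) t0 thc; last first.
        by exists s => //; rewrite hs cos_pihalf.
      by rewrite th0 ge_min le_max hth ltW// orbT.
    rewrite ltr0_norm// in hth.
    have [|s st hs] := @IVT R th 0 t (- (pi / 2)) t0 thc; last first.
      by exists s => //; rewrite hs cosN cos_pihalf.
    have tpi : th t <= - (pi / 2) by rewrite lerNr.
    by rewrite th0 ge_min le_max oppr_le0 (ltW pi20) tpi orbT.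
  move: st; rewrite in_itv/= => /andP[s0 st].
  by have := cth s; rewrite s0 (le_trans st tM) cs0 eqxx => /(_ isT).
have t0M : 0 <= t <= M by rewrite t0.
apply: (le_trans (rate_of_power (hpos t t0M) (phi1 _) thpi n0 dl0 e'dl (dlt t t0M)
  (hphi t t0M))).
have h1 : 3 * (e' / dl) <= e / 2.
  have : e' <= dl * e / 6 by rewrite ge_min lexx orbT.
  move=> h; have : e' / dl <= e / 6 by rewrite ler_pdivrMr// mulrC mulrA.
  lra.
have h2 : dl^-1 ^+ 2 / n%:R <= e / 2.
  rewrite ler_pdivrMr// mulrC -ler_pdivrMr ?divr_gt0//.
  by near: n; exact: nbhs_infty_ger.
lra.
Unshelve. all: by end_near. Qed.

Let psi u := normc (1 - phi u).

Let psi_le2 u : psi u <= 2.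
Proof.
apply: (le_trans (le_normcD _ _)).
by rewrite normcN (_ : 2 = 1 + 1)// lerD// ComplexField.Normc.normc1.
Qed.

Lemma psi_cvg (M e : R) : 0 < e -> \forall n \near \oo, forall t : R, 0 <= t <= M ->
  `|n%:R * psi (t / a n) - t `^ alpha| <= e.
Proof.
move=> e0; have := scaling_rate M e0; apply: filterS => n h t tM.
apply: le_trans (h t tM); have := normcB_le (n%:R%:C%C * (1 - phi (t / a n))) (t `^ alpha)%:C%C.
by rewrite ComplexField.Normc.normcM !normc_real normr_nat (ger0_norm (powR_ge0 _ _)).
Qed.

(** The sequence [a] need not be monotone. Without an upward crossing of level [x] after [N],
    induction would keep it at or below [x] forever. *)
Lemma scaling_bracket N x : a N <= x -> exists2 n, (N <= n)%N & a n <= x < a n.+1.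
Proof.
move=> aN; apply: contrapT => H.
have h k : a (N + k)%N <= x.
  elim: k => [|k IH]; first by rewrite addn0.
  rewrite addnS leNgt; apply/negP => xa; apply: H.
  by exists (N + k)%N; [exact: leq_addr|rewrite IH].
have /cvgryPgt/(_ x)[n _ hn] := scaling_pinfty.
have := hn (N + n)%N; rewrite /= leq_addl => /(_ isT).
by rewrite ltNge h.
Qed.

(** With [a n <= 1 / u < a n.+1], the point [t = u * a n] lies in [[1 / K, 1]]. There [n * psi u] is
    close to [t^alpha] and [n * psi (2 * u)] to [2^alpha * t^alpha]; since [t^alpha] is bounded
    below, the additive error becomes a relative one. *)
Lemma psi_doubling (beta : R) : alpha < beta -> exists2 u0 : R, 0 < u0 &
  forall u, 0 < u <= u0 -> 0 < psi u /\ psi (2 * u) <= 2 `^ beta * psi u.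
Proof.
move=> ab; have [K K0 hK] := scaling_ratio_bounded.
pose A : R := 2 `^ alpha; pose B : R := 2 `^ beta; pose kp := K^-1 `^ alpha.
have AB : A < B.
  rewrite /A /B /powR gt_eqF// ltr_expR ltr_pM2r// ln_gt0//; lra.
have A0 : 0 < A by rewrite powR_gt0.
have kp0 : 0 < kp by rewrite powR_gt0// invr_gt0.
(* The largest error for which [A * x + e <= B * (x - e)] whenever [x >= kp]. *)
pose e := (B - A) * kp / (1 + B).
have B10 : 0 < 1 + B by lra.
have e0 : 0 < e by rewrite divr_gt0// mulr_gt0// subr_gt0.
have eE : e * (1 + B) = (B - A) * kp by rewrite /e divfK// gt_eqF.
have [N1 _ h1] := hK; have [N2 _ h2] := psi_cvg 2 e0.
pose N := (maxn N1 N2).+1.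
have aN0 : 0 < a N by exact: a0.
exists (a N)^-1; first by rewrite invr_gt0.
move=> u /andP[u_gt0 uN].
have [|n Nn /andP[anu anu1]] := @scaling_bracket N u^-1.
  by rewrite -[a N]invrK lef_pV2 ?posrE ?invr_gt0.
have n0 : (0 < n)%N by exact: leq_trans Nn.
have nR0 : (0 : R) < n%:R by rewrite ltr0n.
have an0 : 0 < a n by exact: a0.
pose t := u * a n.
have t0 : 0 < t by rewrite mulr_gt0.
have t1 : t <= 1 by rewrite /t mulrC -ler_pdivlMr// div1r.
have tK : K^-1 <= t.
  have h : a n.+1 <= K * a n.
    by apply: h1; rewrite /=; apply: leq_trans Nn; rewrite ltnW// ltnS leq_maxl.
  have : u * u^-1 < u * (K * a n) by rewrite ltr_pM2l// (lt_le_trans anu1).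
  rewrite mulfV ?gt_eqF// -[K^-1]mul1r ler_pdivrMr// /t; lra.
have x0 : kp <= t `^ alpha.
  by apply: ge0_ler_powR; rewrite ?nnegrE ?invr_ge0 ?(ltW alpha0) ?(ltW K0) ?(ltW t0).
have hn : forall t : R, 0 <= t <= 2 -> `|n%:R * psi (t / a n) - t `^ alpha| <= e.
  by apply: h2; rewrite /=; apply: leq_trans Nn; rewrite ltnW// ltnS leq_maxr.
have k1 := hn t; have k2 := hn (2 * t).
have tu : t / a n = u by rewrite /t mulfK// gt_eqF.
have tu2 : 2 * t / a n = 2 * u by rewrite -mulrA tu.
rewrite tu in k1; rewrite tu2 powRM ?(ltW t0)// -/A in k2.
have /k1 {}k1 : 0 <= t <= 2 by apply/andP; split; lra.
have /k2 {}k2 : 0 <= 2 * t <= 2 by apply/andP; split; lra.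
move: k1 k2; rewrite !ler_norml; set x := t `^ alpha in x0 *.
move=> /andP[k1 _] /andP[_ k2].
have ekp : e < kp.
  rewrite /e ltr_pdivrMr// [kp * _]mulrC ltr_pM2r//; lra.
have Bx : (B - A) * kp <= (B - A) * x by rewrite ler_wpM2l// subr_ge0 ltW.
split.
  have : 0 < n%:R * psi u by lra.
  by rewrite pmulr_rgt0.
have k3 : B * (x - e) <= B * (n%:R * psi u).
  by apply: ler_wpM2l; [exact: ltW (lt_trans A0 AB)|lra].
rewrite -(ler_pM2l nR0) -/B; lra.
Qed.

(** The argument is halved until [t <= 2], each halving costing a factor [2^beta]. Doubling is valid
    only up to [u0]; beyond it [psi <= 2], and [n] itself is bounded by a multiple of [t^beta]. *)
Lemma psi_le_powR (beta : R) : alpha < beta -> exists2 C : R, 0 <= C &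
  \forall n \near \oo, forall t : R, 1 <= t -> n%:R * psi (t / a n) <= C * t `^ beta.
Proof.
move=> ab; have [u0 u0_gt0 hu0] := psi_doubling ab.
have beta0 : 0 < beta by exact: lt_trans ab.
(* Bounds [n * psi (t / a n)] for [t <= 2]: the limit is at most [2^alpha], and an error 1 is
   allowed. *)
pose C0 : R := 2 `^ alpha + 1.
have C00 : 0 < C0 by rewrite ltr_wpDl// powR_ge0.
have psiu0 : 0 < psi u0 by have [] := hu0 u0; rewrite ?u0_gt0 ?lexx.
have pow1 (t : R) : 1 <= t -> 1 <= t `^ beta.
  by move=> t1; rewrite -[leLHS](powRr0 t); apply: ler_powR => //; exact: ltW.
exists (C0 + 2 / psi u0 * C0).
  by rewrite addr_ge0 ?(ltW C00)// mulr_ge0 ?(ltW C00)// divr_ge0// ltW.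
near=> n => t t1.
have n0 : (0 < n)%N by near: n; exact: nbhs_infty_gt.
have nR0 : (0 : R) < n%:R by rewrite ltr0n.
have an0 : 0 < a n by exact: a0.
have base s : 0 <= s <= 2 -> n%:R * psi (s / a n) <= C0.
  have h : forall t : R, 0 <= t <= 2 -> `|n%:R * psi (t / a n) - t `^ alpha| <= 1.
    by near: n; exact: psi_cvg.
  move=> s2; have := h s s2; rewrite ler_norml => /andP[_].
  rewrite lerBlDr addrC => /le_trans; apply; rewrite lerD2r.
  move: s2 => /andP[s0 s2]; apply: ge0_ler_powR; rewrite ?nnegrE ?(ltW alpha0)//.
(* [j] bounds the number of halvings that bring [s] down to at most 2. *)
have small j s : 1 <= s < 2 ^+ j -> s / a n <= u0 ->
    n%:R * psi (s / a n) <= C0 * s `^ beta.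
  elim: j s => [|j IH] s /andP[s1 sj] su; first by rewrite expr0 ltNge s1 in sj.
  have [s2|s2] := leP s 2.
    apply: (le_trans (base s _)); first by rewrite s2 (le_trans _ s1).
    by rewrite ler_peMr ?(ltW C00)// pow1.
  have s20 : 0 < s / 2 by rewrite divr_gt0// (lt_trans _ s2).
  have sE : s / a n = 2 * (s / 2 / a n) by field; rewrite gt_eqF.
  have s2u : 0 < s / 2 / a n <= u0.
    rewrite divr_gt0//=; apply: le_trans su; rewrite ler_wpM2r ?invr_ge0 ?(ltW an0)//.
    lra.
  have [_ hd] := hu0 _ s2u.
  have h1 : n%:R * psi (s / 2 / a n) <= C0 * (s / 2) `^ beta.
    apply: IH; last by case/andP: s2u.
    rewrite exprS in sj; apply/andP; split; lra.
  have sB : s `^ beta = 2 `^ beta * (s / 2) `^ beta.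
    by rewrite -powRM ?(ltW s20)// mulrC divfK.
  have B0 : 0 <= 2 `^ beta :> R by exact: powR_ge0.
  rewrite sE; apply: (@le_trans _ _ (n%:R * (2 `^ beta * psi (s / 2 / a n)))).
    by rewrite ler_wpM2l.
  by rewrite sB mulrCA [leRHS]mulrCA ler_wpM2l.
have smallu s : 1 <= s -> s / a n <= u0 -> n%:R * psi (s / a n) <= C0 * s `^ beta.
  move=> s1; apply: (small (Num.bound s)); rewrite s1/=.
  have s0 : 0 <= s by exact: le_trans s1.
  apply: (lt_le_trans (archi_boundP s0)).
  by rewrite -natrX ler_nat ltnW// ltn_expl.
have [tu|tu] := leP (t / a n) u0.
  apply: (le_trans (smallu t t1 tu)); rewrite ler_wpM2r ?powR_ge0// lerDl.
  by rewrite mulr_ge0 ?(ltW C00)// divr_ge0// ltW.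
(* The bound already known at the limiting point [s / a n = u0] reads [n * psi u0 <= C0 * s^beta],
   which controls [n] because [psi u0 > 0] and [s <= t]. *)
pose s := u0 * a n.
have s1 : 1 <= s.
  rewrite /s mulrC -ler_pdivrMr//; near: n; move/cvgryPge : scaling_pinfty; exact.
have st : s <= t by rewrite /s -ler_pdivlMr// ltW.
have su : s / a n = u0 by rewrite /s mulfK// gt_eqF.
have hs : n%:R * psi u0 <= C0 * s `^ beta by rewrite -{1}su; apply: smallu => //; rewrite su.
have st' : s `^ beta <= t `^ beta.
  apply: ge0_ler_powR => //; rewrite ?nnegrE; [exact: ltW|lra|lra].
have nt : n%:R <= C0 * t `^ beta / psi u0.
  by rewrite ler_pdivlMr// (le_trans hs)// ler_wpM2l// ltW.
apply: (@le_trans _ _ (n%:R * 2)); first by rewrite ler_wpM2l// psi_le2.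
have h0 : 0 <= C0 * t `^ beta by rewrite mulr_ge0 ?powR_ge0// ltW.
have -> : (C0 + 2 / psi u0 * C0) * t `^ beta =
   C0 * t `^ beta + 2 * (C0 * t `^ beta / psi u0) by field; rewrite gt_eqF.
lra.
Unshelve. all: by end_near. Qed.

Hypothesis phiN : forall u, phi (- u) = ((phi u)^*)%C.

(** Up to [M] both terms are [1 - |x|^alpha / n] with an error of smaller order than [1 / n]; beyond
    [M] the distances of both from 1 are simply added. The order of quantifiers matters: [C] is
    chosen before [M] and [e]. *)
Lemma char_fun_rate (beta : R) : alpha < beta -> exists2 C : R, 0 <= C &
  forall M e : R, 1 <= M -> 0 < e -> \forall n \near \oo, forall x : R,
    n%:R * normc (phi (x / a n) - (expR (- (`|x| `^ alpha / n%:R)))%:C%C) <=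
    e + C * (`|x| `^ beta * (M < `|x|)%R%:R).
Proof.
move=> ab; have [C C0 hC] := psi_le_powR ab.
(* [C] bounds the distance of [phi] from 1; the additional 1 pays for the exponential, since
   [x^alpha <= x^beta] for [x >= 1]. *)
exists (C + 1); first by rewrite addr_ge0.
move=> M e M1 e0; have e20 : 0 < e / 2 by rewrite divr_gt0.
near=> n => x.
have n0 : (0 < n)%N by near: n; exact: nbhs_infty_gt.
have nR0 : (0 : R) < n%:R by rewrite ltr0n.
(* Conjugation does not change the distance to a real number. *)
wlog x0 : x / 0 <= x.
  move=> H; have [|/ltW x0] := leP 0 x; first exact: H.
  have := H (- x); rewrite oppr_ge0 normrN mulNr phiN => /(_ x0).
  congr (_ * _ <= _); case: (phi _) => u v /=.
  by rewrite !oppr0 !addr0 sqrrN.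
rewrite (ger0_norm x0); set r := x `^ alpha.
have r0 : 0 <= r by exact: powR_ge0.
pose y := r / n%:R.
have y0 : 0 <= y by rewrite divr_ge0.
have ny : n%:R * y = r by rewrite /y mulrC divfK// gt_eqF.
rewrite -/y; set z := phi (x / a n).
have [xM|xM] := leP x M; rewrite /= ?mulr0 ?addr0 ?mulr1.
  have h1 : normc (n%:R%:C%C * (1 - z) - r%:C%C) <= e / 2.
    have h : forall t : R, 0 <= t <= M ->
      normc (n%:R%:C%C * (1 - phi (t / a n)) - (t `^ alpha)%:C%C) <= e / 2.
      by near: n; exact: scaling_rate.
    by apply: h; rewrite x0.
  have h2 := expRN_approx y0.
  have h3 : n%:R * y ^+ 2 <= e / 2.
    rewrite expr2 mulrA ny /y mulrA ler_pdivrMr// -expr2.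
    rewrite mulrC -ler_pdivrMr//.
    apply: (@le_trans _ _ ((M `^ alpha) ^+ 2 / (e / 2))).
      rewrite ler_wpM2r ?invr_ge0 ?(ltW e20)// lerXn2r ?nnegrE ?powR_ge0//.
      by apply: ge0_ler_powR; rewrite ?nnegrE ?(ltW alpha0)// (le_trans x0).
    by near: n; exact: nbhs_infty_ger.
  rewrite -[X in X * _](ger0_norm (ltW nR0)) -normc_real -ComplexField.Normc.normcM.
  have -> : n%:R%:C%C * (z - (expR (- y))%:C%C) =
     - (n%:R%:C%C * (1 - z) - r%:C%C) + - ((n%:R * (expR (- y) - 1 + y))%:C%C).
    case: (z) => u v; apply/eqP; rewrite eq_complex /= -ny.
    by apply/andP; split; apply/eqP; ring.
  apply: (le_trans (le_normcD _ _)); rewrite !normcN normc_real normrM normr_nat.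
  have : n%:R * `|expR (- y) - 1 + y| <= n%:R * y ^+ 2 by rewrite ler_wpM2l.
  lra.
have x1 : 1 <= x by rewrite (le_trans M1)// ltW.
have h1 : n%:R * psi (x / a n) <= C * x `^ beta.
  have h : forall t : R, 1 <= t -> n%:R * psi (t / a n) <= C * t `^ beta by near: n.
  exact: h.
have h2 : r <= x `^ beta by apply: ler_powR => //; exact: ltW.
have h3 : normc (z - (expR (- y))%:C%C) <= psi (x / a n) + y.
  have -> : z - (expR (- y))%:C%C = - (1 - z) + (1 - expR (- y))%:C%C.
    case: (z) => u v; apply/eqP; rewrite eq_complex /=.
    by apply/andP; split; apply/eqP; ring.
  apply: (le_trans (le_normcD _ _)); rewrite normcN lerD2l normc_real.
  rewrite ger0_norm ?subr_ge0 ?expRN_le1//.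
  by have := expR_ge1Dx (- y); lra.
apply: (@le_trans _ _ (n%:R * (psi (x / a n) + y))); first by rewrite ler_wpM2l.
rewrite mulrDr ny mulrDl mul1r; lra.
Unshelve. all: by end_near. Qed.

End scaling.

(** * Characteristic functions of weighted sums *)

Section char_fun_properties.
Context d (T : measurableType d) (R : realType) (P : probability T R).
Variable X : {mfun T >-> R}.

Lemma char_fun0 : char_fun P X 0 = 1.
Proof.
rewrite char_funE; apply/eqP; rewrite eq_complex/=; apply/andP; split; apply/eqP.
  rewrite -[RHS](Rintegral_prob_cst P); apply: eq_Rintegral => w _.
  by rewrite mul0r cos0.
rewrite -[RHS](Rintegral_prob_cst P); apply: eq_Rintegral => w _.
by rewrite mul0r sin0.
Qed.

Lemma char_funN t : char_fun P X (- t) = ((char_fun P X t)^*)%C.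
Proof.
rewrite !char_funE /=; congr Complex.
  by apply: eq_Rintegral => w _; rewrite mulNr cosN.
rewrite -[RHS]mulN1r -RintegralZl//; last exact: integrable_sin_mfun.
by apply: eq_Rintegral => w _; rewrite mulNr sinN mulN1r.
Qed.

(** With [q = c^2 + s^2], the integral of [c cos + s sin] equals [q], while pointwise the integrand
    is at most [(q + 1) / 2]; hence [q <= 1]. *)
Lemma normc_char_fun_le1 t : normc (char_fun P X t) <= 1.
Proof.
rewrite char_funE; set c := \int[P]_w cos _; set s := \int[P]_w sin _ => /=.
suff q1 : c ^+ 2 + s ^+ 2 <= 1 by rewrite -sqrtr1 ler_wsqrtr.
have icos := integrable_cos_mfun P X t; have isin := integrable_sin_mfun P X t.
have i1 : P.-integrable setT (EFin \o (fun w => c * cos (t * X w))).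
  by have := integrableZl measurableT c icos; apply: eq_integrable.
have i2 : P.-integrable setT (EFin \o (fun w => s * sin (t * X w))).
  by have := integrableZl measurableT s isin; apply: eq_integrable.
have qE : c ^+ 2 + s ^+ 2 = \int[P]_w (c * cos (t * X w) + s * sin (t * X w)).
  by rewrite RintegralD// !RintegralZl// !expr2.
have : c ^+ 2 + s ^+ 2 <= (c ^+ 2 + s ^+ 2 + 1) / 2.
  rewrite {1}qE -[leRHS](Rintegral_prob_cst P); apply: le_Rintegral => //.
  - by have := integrableD measurableT i1 i2; apply: eq_integrable.
  - exact: (bounded_integrable `|(c ^+ 2 + s ^+ 2 + 1) / 2|).
  move=> w _; have := cos2Dsin2 (t * X w).
  have := sqr_ge0 (c - cos (t * X w)); have := sqr_ge0 (s - sin (t * X w)).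
  rewrite !expr2; lra.
lra.
Qed.

Lemma continuous_Rintegral_mul (f : R -> R) : continuous f -> (forall x, `|f x| <= 1) ->
  continuous (fun t : R => \int[P]_w f (t * X w)).
Proof.
move=> cf f1 t.
have mf s : measurable_fun setT (fun w => f (s * X w)).
  apply: (measurableT_comp (f := f)); first exact: continuous_measurable_fun.
  exact: measurable_funM.
have ic : P.-integrable setT (EFin \o (fun _ : T => 1 : R)).
  by apply: (bounded_integrable 1) => // w; rewrite normr1.
have tI : t \in (`]t - 1, t + 1[%classic : set R).
  by rewrite inE/= in_itv/= gtrBl ltrDl ltr01.
apply: (continuity_under_integral (f := fun s w => f (s * X w)) measurableT
  (g := fun=> 1) _ _ ic _ tI).
- by move=> s _; apply: (bounded_integrable 1).
- apply: aeW => w _ s _; apply: (@continuous_comp _ _ _ (fun s : R => s * X w)).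
    by apply: cvgM; [exact: cvg_id|exact: cvg_cst].
  exact: cf.
- by move=> s _; apply: aeW => w _; exact: f1.
Qed.

Lemma continuous_Re_char_fun : continuous (fun t : R => Re (char_fun P X t)).
Proof.
under eq_fun do rewrite char_funE /=.
by apply: continuous_Rintegral_mul; [exact: continuous_cos|exact: cos_max].
Qed.

Lemma continuous_Im_char_fun : continuous (fun t : R => Im (char_fun P X t)).
Proof.
under eq_fun do rewrite char_funE /=.
by apply: continuous_Rintegral_mul; [exact: continuous_sin|exact: sin_max].
Qed.

Lemma char_fun_distribution (Y : {mfun T >-> R}) t :
  (forall B, measurable B -> distribution P X B = distribution P Y B) ->
  char_fun P X t = char_fun P Y t.
Proof.
move=> XY.
have h (f : R -> R) : continuous f -> (forall x, `|f x| <= 1) ->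
    \int[P]_w f (t * X w) = \int[P]_w f (t * Y w).
  move=> cf f1; congr fine.
  have mf : measurable_fun setT (fun x => (f (t * x))%:E).
    apply/measurable_EFinP; apply: (measurableT_comp (f := f)).
      exact: continuous_measurable_fun.
    exact: measurable_funM.
  have mfZ (Z : {mfun T >-> R}) : P.-integrable setT ((fun x => (f (t * x))%:E) \o Z).
    apply: (bounded_integrable (f := fun w => f (t * Z w)) 1) => //.
    apply: (measurableT_comp (f := f)); first exact: continuous_measurable_fun.
    exact: measurable_funM.
  transitivity (\int[distribution P X]_x (f (t * x))%:E)%E.
    by rewrite integral_distribution//; exact: mfZ.
  transitivity (\int[distribution P Y]_x (f (t * x))%:E)%E.
    by apply: eq_measure_integral => B mB _; exact: XY.
  by rewrite integral_distribution//; exact: mfZ.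
rewrite !char_funE; congr Complex; apply: h.
- exact: continuous_cos.
- exact: cos_max.
- exact: continuous_sin.
- exact: sin_max.
Qed.

End char_fun_properties.

Section iid_row_sum.
Context d d' (T : measurableType d) (T' : measurableType d') (R : realType).
Variables (P : probability T R) (P' : probability T' R).
Variables (xi : nat -> {mfun T >-> R}) (a : nat -> R) (S : {mfun T' >-> R}).
Variable alpha : R.
Hypothesis hiid : iid P [set k | (1 <= k)%N] xi.
Hypothesis hS : forall t, char_fun P' S t = (expR (- (`|t| `^ alpha)))%:C%C.
Hypothesis hxiS : cvg_in_distribution P P' (row_sum a (fun _ k => xi k)) S.

Lemma char_fun_iid k t : (1 <= k)%N -> char_fun P (xi k) t = char_fun P (xi 1%N) t.
Proof.
move=> k1; apply: char_fun_distribution => B mB.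
by have [_ hid] := hiid; apply: hid.
Qed.

Lemma char_fun_row_sum n t : char_fun P (xi 1%N) (t / a n) ^+ n =
  char_fun P (row_sum a (fun _ k => xi k) n) t.
Proof.
have [hind _] := hiid.
have -> : char_fun P (xi 1%N) (t / a n) ^+ n =
    \prod_(1 <= k < n.+1) char_fun P (xi k) (t / a n).
  rewrite (eq_big_nat _ _ (F2 := fun=> char_fun P (xi 1%N) (t / a n))).
    by rewrite prodr_const_nat subn1.
  by move=> k /andP[k1 _]; exact: char_fun_iid.
rewrite -(char_fun_lin_comb hind (fun=> t / a n)) char_funE.
by congr Complex; apply: eq_Rintegral => w _; rewrite /row_sum mulrA mulr_sumr.
Qed.

(** For [0 <= t <= M] the functions [cos (t x)] and [sin (t x)] share the Lipschitz constant [|M|],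
    so weak convergence is uniform over them. *)
Lemma char_fun_row_sum_cvg (M e : R) : 0 < e -> \forall n \near \oo,
  forall t : R, 0 <= t <= M ->
    normc (char_fun P (xi 1%N) (t / a n) ^+ n - (expR (- (t `^ alpha)))%:C%C) <= e.
Proof.
move=> e0; have e20 : 0 < e / 2 by rewrite divr_gt0.
have := cvg_lipschitz_expectation hxiS (normr_ge0 M) e20.
apply: filterS => n h t /andP[t0 tM].
rewrite char_fun_row_sum -[t in t `^ alpha](ger0_norm t0) -hS !char_funE.
apply: (le_trans (normc_le_ReIm _)); rewrite /= [e]splitr.
have L (f : R -> R) : (forall x y, `|f x - f y| <= `|x - y|) ->
    forall x y, `|f (t * x) - f (t * y)| <= `|M| * `|x - y|.
  move=> fL x y; apply: (le_trans (fL _ _)).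
  by rewrite -mulrBr normrM ler_wpM2r// (ger0_norm t0) (le_trans tM)// ler_norm.
apply: lerD.
  apply: (h (fun x => cos (t * x))) => [x|]; first exact: cos_max.
  by apply: L; exact: cos_lipschitz.
apply: (h (fun x => sin (t * x))) => [x|]; first exact: sin_max.
by apply: L; exact: sin_lipschitz.
Qed.

End iid_row_sum.

(** The absolute value extends the Laplace kernel to a bounded Lipschitz function on the whole line,
    hence to a test function for [cvg_lipschitz_expectation]. *)
Lemma expRN_lipschitz (R : realType) (l x y : R) : 0 <= l ->
  `|expR (- (l * `|x|)) - expR (- (l * `|y|))| <= l * `|x - y|.
Proof.
move=> l0.
have h u v : 0 <= u -> u <= v -> `|expR (- u) - expR (- v)| <= v - u.
  move=> u0 uv; rewrite ger0_norm ?subr_ge0 ?ler_expR ?lerN2//.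
  have -> : expR (- v) = expR (- u) * expR (- (v - u)).
    by rewrite -expRD; congr expR; ring.
  rewrite -[X in X - _]mulr1 -mulrBr; apply: (@le_trans _ _ (1 - expR (- (v - u)))).
    by rewrite ler_piMl ?expRN_le1// subr_ge0 expRN_le1// subr_ge0.
  by have := expR_ge1Dx (- (v - u)); lra.
have : `|expR (- (l * `|x|)) - expR (- (l * `|y|))| <= `|l * `|x| - l * `|y| |.
  have [xy|/ltW xy] := leP (l * `|x|) (l * `|y|).
    by rewrite distrC [leRHS]distrC [leRHS]ger0_norm ?subr_ge0// distrC h ?mulr_ge0.
  by rewrite distrC [leRHS]ger0_norm ?subr_ge0// h ?mulr_ge0.
move/le_trans; apply; rewrite -mulrBr normrM ger0_norm// ler_wpM2l//.
exact: ler_dist_dist.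
Qed.

Lemma expR_sum_nat (R : realType) (f : nat -> R) m n :
  expR (\sum_(m <= k < n) f k) = \prod_(m <= k < n) expR (f k).
Proof.
rewrite /index_iota; elim: (iota _ _) => [|k s IH]; first by rewrite !big_nil expR0.
by rewrite !big_cons expRD IH.
Qed.

Section weighted_row_sum.
Context d (T : measurableType d) (R : realType) (P : probability T R).
Variables (xi : nat -> {mfun T >-> R}) (a : nat -> R).
Variable W : nat -> nat -> {mfun T >-> R}.
Hypothesis hiid : iid P [set k | (1 <= k)%N] xi.
Hypothesis hindep : independent_families P
    [set nk : nat * nat | (1 <= nk.2 <= nk.1)%N] [set k | (1 <= k)%N]
    (fun nk => W nk.1 nk.2) xi.

Let phi := char_fun P (xi 1%N).

(** Freeze the weights: what is left is a linear combination of the [xi k]. Independence of the two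
    generated sigma-algebras allows this for the whole array at once, and measurability of the
    product is obtained because it is an inner integral. *)
Lemma char_fun_weighted_row_sum n t :
  let p w := \prod_(1 <= k < n.+1) phi (t * W n k w / a n) in
  [/\ measurable_fun setT (fun w => Re (p w)), measurable_fun setT (fun w => Im (p w)) &
  char_fun P (row_sum a (fun n k => W n k \* xi k) n) t =
    (\int[P]_w Re (p w) +i* \int[P]_w Im (p w))%C].
Proof.
move=> p; have [hind _] := hiid.
pose D := [set nk : nat * nat | (1 <= nk.2 <= nk.1)%N].
pose D' := [set k : nat | (1 <= k)%N].
pose W' (nk : nat * nat) := W nk.1 nk.2.
pose E1 : measurableType _ := family_type D W'.
pose E2 : measurableType _ := family_type D' xi.
pose g (z : E1 * E2) := t * ((a n)^-1 * \sum_(1 <= k < n.+1) W n k z.1 * xi k z.2).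
have mg : measurable_fun setT g.
  apply: measurable_funM => //; apply: measurable_funM => //.
  apply: measurable_sum_nat => k /andP[k1 kn]; apply: measurable_funM.
    apply: (measurableT_comp (f := (W n k : E1 -> R))) => //.
    by apply: (@measurable_family _ _ _ _ D W' (n, k)); rewrite /D/= k1.
  apply: (measurableT_comp (f := (xi k : E2 -> R))) => //.
  exact: (@measurable_family _ _ _ _ D' xi k).
have indep (A : set E1) (B : set E2) : measurable A -> measurable B ->
    P (family_id D W' @^-1` A `&` family_id D' xi @^-1` B) =
    (P (family_id D W' @^-1` A) * P (family_id D' xi @^-1` B))%E.
  by move=> mA mB; apply: hindep.
have mh (h : R -> R) : continuous h -> measurable_fun setT (fun z => h (g z)).
  move=> ch; apply: (measurableT_comp (f := h)) => //; exact: continuous_measurable_fun.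
have [mc hc] := Rintegral_independent indep (mh _ (@continuous_cos R))
  (fun z => cos_max _).
have [ms hs] := Rintegral_independent indep (mh _ (@continuous_sin R))
  (fun z => sin_max _).
have inner w1 : (\int[P]_w2 cos (g (family_id D W' w1, family_id D' xi w2)) +i*
    \int[P]_w2 sin (g (family_id D W' w1, family_id D' xi w2)))%C = p w1.
  rewrite /p (eq_big_nat _ _ (F2 := fun k => char_fun P (xi k) (t * W n k w1 / a n))).
    rewrite -(char_fun_lin_comb hind (fun k => t * W n k w1 / a n)).
    congr Complex; apply: eq_Rintegral => w2 _; rewrite /g/=.
      by congr cos; rewrite !mulr_sumr; apply: eq_bigr => k _; rewrite /family_id; ring.
    by congr sin; rewrite !mulr_sumr; apply: eq_bigr => k _; rewrite /family_id; ring.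
  by move=> k /andP[k1 _]; rewrite (char_fun_iid hiid).
have innerc w1 : \int[P]_w2 cos (g (family_id D W' w1, family_id D' xi w2)) = Re (p w1).
  by rewrite -inner.
have inners w1 : \int[P]_w2 sin (g (family_id D W' w1, family_id D' xi w2)) = Im (p w1).
  by rewrite -inner.
split.
- by under eq_fun do rewrite -innerc.
- by under eq_fun do rewrite -inners.
rewrite char_funE; congr Complex.
  rewrite -[LHS]/(\int[P]_w cos (g (family_id D W' w, family_id D' xi w))) hc.
  by apply: eq_Rintegral => w _; exact: innerc.
rewrite -[LHS]/(\int[P]_w sin (g (family_id D W' w, family_id D' xi w))) hs.
by apply: eq_Rintegral => w _; exact: inners.
Qed.

End weighted_row_sum.

(** * Truncation of the weights and comparison with the Laplace transform *)

Section tail.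
Context d (T : measurableType d) (R : realType) (P : probability T R).
Variables (W : nat -> {mfun T >-> R}) (beta c : R) (n : nat).

(** The pathwise counterpart of the average in [A6], which is its expectation. *)
Definition row_tail (w : T) : R := n%:R^-1 *
  \sum_(1 <= k < n.+1) `|W k w| `^ beta * \1_[set v | c < `|W k v|] w.

Lemma row_tail_ge0 w : 0 <= row_tail w.
Proof.
by rewrite mulr_ge0// sumr_ge0// => k _; rewrite mulr_ge0 ?powR_ge0.
Qed.

Let mterm k : measurable_fun setT
  (fun w => `|W k w| `^ beta * \1_[set v | c < `|W k v|] w : R).
Proof.
apply: measurable_funM; first exact: (measurable_mfun_abs_power beta (W k)).
apply: measurable_indic.
rewrite (_ : [set v | _] = (fun v => `|W k v|) @^-1` `]c, +oo[).
  rewrite -[X in measurable X]setTI; apply: measurableT_comp => //.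
by apply/seteqP; split=> v /=; rewrite in_itv/= andbT.
Qed.

Lemma measurable_row_tail : measurable_fun setT row_tail.
Proof. by apply: measurable_funM => //; apply: measurable_sum. Qed.

Lemma integral_row_tail : (\int[P]_w (row_tail w)%:E =
  n%:R^-1%:E * \sum_(1 <= k < n.+1) tail_moment P beta c (W k))%E.
Proof.
under eq_integral do rewrite /row_tail EFinM -sumEFin.
rewrite ge0_integralZl//; last 2 first.
- by apply: emeasurable_sum => k; apply/measurable_EFinP.
- by move=> w _; apply: sume_ge0 => k _; rewrite lee_fin mulr_ge0 ?powR_ge0.
congr (_ * _)%E; rewrite ge0_integral_sum//.
- by apply: eq_bigr => k _; rewrite /tail_moment unlock.
- by move=> k; apply/measurable_EFinP.
Qed.

Lemma row_tail_le (e : R) :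
  (n%:R^-1%:E * \sum_(1 <= k < n.+1) tail_moment P beta c (W k) <= e%:E)%E ->
  P.-integrable setT (EFin \o row_tail) /\ \int[P]_w row_tail w <= e.
Proof.
rewrite -integral_row_tail => h.
have int : P.-integrable setT (EFin \o row_tail).
  apply/integrableP; split; first by apply/measurable_EFinP; exact: measurable_row_tail.
  under eq_integral do rewrite /= ger0_norm ?row_tail_ge0//.
  by rewrite (le_lt_trans h)// ltry.
by split=> //; rewrite -lee_fin -EFin_Rintegral.
Qed.

End tail.

Section comparison.
Context (R : realType) (phi : R -> R[i]) (a : nat -> R) (alpha beta C c e t : R).
Context d (T : measurableType d) (W : nat -> {mfun T >-> R}) (n : nat).
Hypothesis phi1 : forall u, normc (phi u) <= 1.
Hypothesis C0 : 0 <= C.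
Hypothesis n0 : (0 < n)%N.
Hypothesis rate : forall x : R,
  n%:R * normc (phi (x / a n) - (expR (- (`|x| `^ alpha / n%:R)))%:C%C) <=
  e + C * (`|x| `^ beta * ((`|t| + 1) * c < `|x|)%R%:R).

(** The exponential of the sum is itself a product over [k], so the products are compared factor by
    factor; each of the [n] errors carries a factor [1 / n], and the [n] copies of [e / n] add up to
    [e]. *)
Lemma char_fun_comparison w :
  normc (\prod_(1 <= k < n.+1) phi (t * W k w / a n) -
    (expR (- (`|t| `^ alpha *
      (n%:R^-1 * \sum_(1 <= k < n.+1) mfun_abs_power alpha (W k) w))))%:C%C) <=
  e + C * `|t| `^ beta * row_tail W beta c n w.
Proof.
have nR0 : (0 : R) < n%:R by rewrite ltr0n.
pose z' k : R[i] := (expR (- (`|t * W k w| `^ alpha / n%:R)))%:C%C.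
have -> : (expR (- (`|t| `^ alpha *
    (n%:R^-1 * \sum_(1 <= k < n.+1) mfun_abs_power alpha (W k) w))))%:C%C =
    \prod_(1 <= k < n.+1) z' k.
  rewrite complex_prod_real -expR_sum_nat; congr (expR _)%:C%C.
  rewrite sumrN mulrA mulr_sumr; congr (- _); apply: eq_bigr => k _.
  by rewrite normrM powRM// /mfun_abs_power; ring.
apply: (@le_trans _ _ (\sum_(1 <= k < n.+1) normc (phi (t * W k w / a n) - z' k))).
  apply: (normc_prodB_le (z := fun k => phi (t * W k w / a n))) => // k.
  by rewrite normc_real (ger0_norm (expR_ge0 _)) expRN_le1// divr_ge0// powR_ge0.
have -> : e + C * `|t| `^ beta * row_tail W beta c n w = \sum_(1 <= k < n.+1)
    n%:R^-1 * (e + C * `|t| `^ beta * (`|W k w| `^ beta * \1_[set v | c < `|W k v|] w)).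
  under [RHS]eq_bigr do rewrite mulrDr.
  rewrite big_split/= sumr_const_nat subn1/=; congr (_ + _).
    by rewrite -[RHS]mulr_natr mulrAC mulVf ?gt_eqF// mul1r.
  rewrite /row_tail mulr_sumr mulr_sumr.
  by apply: eq_bigr => k _; ring.
apply: ler_sum => k _.
rewrite [leRHS]mulrC ler_pdivlMr// mulrC.
apply: (le_trans (rate (t * W k w))); rewrite lerD2l -!mulrA ler_wpM2l//.
rewrite normrM powRM// -mulrA ler_wpM2l ?powR_ge0// ler_wpM2l ?powR_ge0// indicE.
(* The threshold [(|t| + 1) * c] ensures that [|t W|] exceeds it only if [|W| > c], the event in
   [row_tail]. *)
have [h|_] := ltP ((`|t| + 1) * c) (`|t| * `|W k w|); last by rewrite /= ler0n.
rewrite mem_set//=; have := normr_ge0 t; have := normr_ge0 (W k w).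
have [//|Wc] := ltP c `|W k w|.
move=> W0 t0; move: h; rewrite ltNge; apply: contraNP => _.
by rewrite ler_pM// lerDl.
Qed.

End comparison.

Section scale_mixture.
Context d (T : measurableType d) (R : realType) (P : probability T R).
Variables (alpha : R) (S V : {mfun T >-> R}).
Hypothesis alpha0 : 0 < alpha.
Hypothesis hS : forall t, char_fun P S t = (expR (- (`|t| `^ alpha)))%:C%C.
Hypothesis V0 : forall w, 0 <= V w.
Hypothesis VS : independent_RVs P V S.

(** For a frozen value [v] of [V], the characteristic function of [S] at [t * v^(1/alpha)] is
    [exp (- |t|^alpha * v)]. Thus the result is a Laplace transform of [V]. *)
Lemma char_fun_scale_mixture t : char_fun P (mfun_power alpha^-1 V \* S) t =
  (\int[P]_w expR (- (`|t| `^ alpha * `|V w|)))%:C%C.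
Proof.
pose g (z : R * R) := t * (z.1 `^ alpha^-1 * z.2).
have mg : measurable_fun setT g.
  apply: measurable_funM => //; apply: measurable_funM => //.
  apply: (measurableT_comp (f := fun x : R => x `^ alpha^-1)).
    exact: measurable_powR.
  exact: measurable_fst.
have mh (h : R -> R) : continuous h -> measurable_fun setT (fun z => h (g z)).
  move=> ch; apply: (measurableT_comp (f := h)) => //; exact: continuous_measurable_fun.
have [_ hc] := Rintegral_independent VS (mh _ (@continuous_cos R)) (fun z => cos_max _).
have [_ hs] := Rintegral_independent VS (mh _ (@continuous_sin R)) (fun z => sin_max _).
have inner w : char_fun P S (t * V w `^ alpha^-1) =
    (expR (- (`|t| `^ alpha * `|V w|)))%:C%C.
  rewrite hS normrM (ger0_norm (powR_ge0 _ _)) powRM ?powR_ge0// -powRrM.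
  by rewrite mulVf ?gt_eqF// powRr1// (ger0_norm (V0 w)).
have innerE w (h : R -> R) : \int[P]_v h (g (V w, S v)) =
    \int[P]_v h (t * V w `^ alpha^-1 * S v).
  by apply: eq_Rintegral => v _; rewrite /g/= mulrA.
rewrite char_funE; congr Complex.
  rewrite -[LHS]/(\int[P]_w cos (g (V w, S w))) hc; apply: eq_Rintegral => w _.
  by rewrite innerE; have := inner w; rewrite char_funE => -[].
rewrite -[LHS]/(\int[P]_w sin (g (V w, S w))) hs -[RHS](Rintegral_prob_cst P).
apply: eq_Rintegral => w _.
by rewrite innerE; have := inner w; rewrite char_funE => -[].
Qed.

End scale_mixture.

Theorem theorem2p3 (R : realType)
  (d : measure_display) (T : measurableType d) (P : probability T R)
  (d' : measure_display) (T' : measurableType d') (P' : probability T' R)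
  (alpha : R) (halpha : 0 < alpha < 2)
  (xi : nat -> {RV P >-> R}) (a : nat -> R)
  (hiid : iid P [set k | (1 <= k)%N] xi)
  (ha : forall n, (1 <= n)%N -> 0 < a n)
  (S : {RV P' >-> R})
  (hS : forall t : R, char_fun P' S t = (expR (- (`|t| `^ alpha)))%:C%C)
  (hxiS : cvg_in_distribution P P' (row_sum a (fun _ k => xi k)) S)
  (W : nat -> nat -> {RV P >-> R})
  (hindep : independent_families P
    [set nk : nat * nat | (1 <= nk.2 <= nk.1)%N] [set k | (1 <= k)%N]
    (fun nk => W nk.1 nk.2) xi)
  (F : cumulativeBounded (0 : R) (1 : R))
  (A5 : cvg_in_distribution_to P
    (row_sum (fun n => n%:R) (fun n k => mfun_abs_power alpha (W n k))) F)
  (A6 : exists beta : R, [/\ 1 <= beta, alpha < beta &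
    ereal_sup [set ((n%:R^-1)%:E
        * \sum_(1 <= k < n.+1) tail_moment P beta c (W n k))%E
      | n in [set n | (1 <= n)%N]] @[c --> +oo] --> 0%E])
  (Winf : {RV P' >-> R}) (hWinf0 : forall w, 0 <= Winf w)
  (hWinfF : has_distribution_function P' Winf F)
  (hWinfS : independent_RVs P' Winf S) :
  cvg_in_distribution P P' (row_sum a (fun n k => W n k \* xi k))
    (mfun_power alpha^-1 Winf \* S).
Proof.
have /andP[alpha0 _] := halpha.
pose phi := char_fun P (xi 1%N).
pose X n : {mfun T >-> R} := row_sum a (fun n k => W n k \* xi k) n.
pose Vn n : {mfun T >-> R} :=
  row_sum (fun n => n%:R) (fun n k => mfun_abs_power alpha (W n k)) n.
have Vn0 n w : 0 <= Vn n w.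
  by rewrite /Vn/= /row_sum mulr_ge0// sumr_ge0// => k _; exact: powR_ge0.
have [beta [_ alphabeta tail0]] := A6.
have [C C0 rate] := char_fun_rate (char_fun0 P (xi 1%N))
  (@continuous_Re_char_fun _ _ _ P (xi 1%N)) (@continuous_Im_char_fun _ _ _ P (xi 1%N))
  (normc_char_fun_le1 P (xi 1%N)) ha alpha0
  (char_fun_row_sum_cvg hiid hS hxiS) (char_funN P (xi 1%N)) alphabeta.
have VnW : cvg_in_distribution P P' Vn Winf.
  rewrite /cvg_in_distribution (_ : (fun x => _) = F); first exact: A5.
  by apply/funext => x; rewrite hWinfF.
have laplace (t : R) : \int[P]_w expR (- (`|t| `^ alpha * `|Vn n w|)) @[n --> \oo] -->
    \int[P']_w expR (- (`|t| `^ alpha * `|Winf w|)).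
  apply/cvgrPdist_le => e e0.
  have l0 : 0 <= `|t| `^ alpha by exact: powR_ge0.
  have := cvg_lipschitz_expectation VnW l0 e0; apply: filterS => n h.
  rewrite distrC; apply: (h (fun x => expR (- (`|t| `^ alpha * `|x|)))) => [x|x y].
    by rewrite ger0_norm ?expR_ge0// expRN_le1// mulr_ge0.
  exact: expRN_lipschitz.
have near_laplace (t e : R) : 0 < e -> \forall n \near \oo,
    `|Re (char_fun P (X n) t) - \int[P]_w expR (- (`|t| `^ alpha * `|Vn n w|))| <= e /\
    `|Im (char_fun P (X n) t)| <= e.
  move=> e0; pose B := C * `|t| `^ beta.
  have B0 : 0 <= B by rewrite mulr_ge0// powR_ge0.
  (* Chosen so that the tail, multiplied by [B], contributes at most [e / 2]; the denominator uses
     [B + 1] because [B] may be 0. *)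
  pose e2 := e / (2 * (B + 1)).
  have B1 : 0 < B + 1 by rewrite ltr_wpDl.
  have e20 : 0 < e2 by rewrite divr_gt0// mulr_gt0.
  have Be2 : B * e2 <= e / 2.
    have : e2 * (B + 1) = e / 2 by rewrite /e2; field; rewrite gt_eqF.
    lra.
  (* One truncation level serves all rows, because [A6] controls the supremum over [n]. *)
  have [c [c1 tailc]] : exists c : R, 1 <= c /\ forall n, (1 <= n)%N ->
      ((n%:R^-1)%:E * \sum_(1 <= k < n.+1) tail_moment P beta c (W n k) <= e2%:E)%E.
    have /fine_cvgP[fin /cvgrPdist_le/(_ _ e20) small] := tail0.
    near (pinfty_nbhs R) => c; exists c.
    split; first by near: c; exact: nbhs_pinfty_ge.
    move=> n n1.
    apply: (@le_trans _ _ (ereal_sup [set ((n%:R^-1)%:E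
        * \sum_(1 <= k < n.+1) tail_moment P beta c (W n k))%E
      | n in [set n | (1 <= n)%N]])).
      by apply: ereal_sup_ubound; exists n.
    rewrite -[leLHS]fineK; last by near: c.
    rewrite lee_fin (le_trans (ler_norm _))// -normrN -sub0r.
    by near: c.
  have c0 : 0 <= c by exact: le_trans c1.
  have e20' : 0 < e / 2 by rewrite divr_gt0.
  (* [rate] asks for a threshold at least 1; this is why [c >= 1] was required. *)
  have M1 : 1 <= (`|t| + 1) * c.
    by rewrite -[leLHS]mulr1 ler_pM// lerDr.
  near=> n.
  have n0 : (0 < n)%N by near: n; exact: nbhs_infty_gt.
  have raten : forall x : R,
      n%:R * normc (phi (x / a n) - (expR (- (`|x| `^ alpha / n%:R)))%:C%C) <=
      e / 2 + C * (`|x| `^ beta * ((`|t| + 1) * c < `|x|)%R%:R).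
    by near: n; exact: rate.
  have [mRe mIm charX] := char_fun_weighted_row_sum a hiid hindep n t.
  have [iG G_le] := row_tail_le (tailc n n0).
  have bound w := char_fun_comparison (W n) (normc_char_fun_le1 P (xi 1%N)) C0
    n0 raten w.
  pose p w := \prod_(1 <= k < n.+1) phi (t * W n k w / a n).
  pose q w := expR (- (`|t| `^ alpha * `|Vn n w|)).
  (* A pathwise majorant of the distance from the product to the exponential; its mean is at most
     [e / 2 + B * e2 <= e]. *)
  pose h w := e / 2 + B * row_tail (W n) beta c n w.
  have p1 w : normc (p w) <= 1.
    by apply: (normc_prod_le1 (z := fun k => phi (t * W n k w / a n))) => k;
      exact: normc_char_fun_le1.
  have pqh w : normc (p w - (q w)%:C%C) <= h w.
    by rewrite /q (ger0_norm (Vn0 n w)); exact: bound.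
  have iRe : P.-integrable setT (EFin \o (fun w => Re (p w))).
    by apply: (bounded_integrable 1) => // w; exact: le_trans (normc_Re_le _) (p1 w).
  have iIm : P.-integrable setT (EFin \o (fun w => Im (p w))).
    by apply: (bounded_integrable 1) => // w; exact: le_trans (normc_Im_le _) (p1 w).
  have iq : P.-integrable setT (EFin \o q).
    apply: (bounded_integrable 1) => [|w].
      have cf : continuous (fun x : R => expR (- (`|t| `^ alpha * `|x|))).
        apply: (lipschitz_continuous (powR_ge0 `|t| alpha)) => x y.
        exact: expRN_lipschitz (powR_ge0 _ _).
      exact: (measurableT_comp (continuous_measurable_fun cf)).
    by rewrite ger0_norm ?expR_ge0// expRN_le1// mulr_ge0 ?powR_ge0.
  have ic : P.-integrable setT (EFin \o (fun _ : T => e / 2)).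
    exact: (bounded_integrable `|e / 2|).
  have iBG : P.-integrable setT (EFin \o (fun w => B * row_tail (W n) beta c n w)).
    by have := integrableZl measurableT B iG; apply: eq_integrable.
  have ih : P.-integrable setT (EFin \o h).
    by have := integrableD measurableT ic iBG; apply: eq_integrable.
  have h_le : \int[P]_w h w <= e.
    rewrite /h RintegralD// Rintegral_prob_cst RintegralZl//.
    have : B * \int[P]_w row_tail (W n) beta c n w <= B * e2 by rewrite ler_wpM2l.
    lra.
  rewrite /X charX /= -/phi; split; apply: le_trans h_le.
    apply: normr_RintegralB_le => // w; apply: le_trans (pqh w).
    by have := normc_Re_le (p w - (q w)%:C%C); rewrite raddfB.
  rewrite -[\int[P]_w _]subr0 -[X in _ - X](Rintegral_prob_cst P).
  apply: normr_RintegralB_le => //.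
    by apply: (bounded_integrable 0) => // w; rewrite normr0.
  move=> w; apply: le_trans (pqh w).
  by have := normc_Im_le (p w - (q w)%:C%C); rewrite raddfB.
have charY t := char_fun_scale_mixture alpha0 hS hWinf0 hWinfS t.
(* The cosine part combines the comparison with the exponential and the convergence of the Laplace
   transforms, each costing [e / 2]. *)
apply: (@levy_continuity _ _ _ _ _ P P' X) => t.
  have -> : \int[P']_w cos (t * (mfun_power alpha^-1 Winf \* S) w) =
      \int[P']_w expR (- (`|t| `^ alpha * `|Winf w|)).
    by have := charY t; rewrite char_funE => -[].
  apply/cvgrPdist_le => e e0; have e20 : 0 < e / 2 by rewrite divr_gt0.
  near=> n.
  have [h1 _] : `|Re (char_fun P (X n) t) -
        \int[P]_w expR (- (`|t| `^ alpha * `|Vn n w|))| <= e / 2 /\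
      `|Im (char_fun P (X n) t)| <= e / 2 by near: n; exact: near_laplace.
  have h2 : `|\int[P']_w expR (- (`|t| `^ alpha * `|Winf w|)) -
      \int[P]_w expR (- (`|t| `^ alpha * `|Vn n w|))| <= e / 2.
    by near: n; move/cvgrPdist_le : (laplace t); apply.
  rewrite char_funE /= distrC in h1; rewrite [e]splitr.
  apply: le_trans (lerD h2 h1); apply: le_trans (ler_normD _ _).
  by rewrite le_eqVlt; apply/orP; left; apply/eqP; congr `|_|; ring.
(* The characteristic function of the limit is real. *)
have -> : \int[P']_w sin (t * (mfun_power alpha^-1 Winf \* S) w) = 0.
  by have := charY t; rewrite char_funE => -[].
apply/cvgrPdist_le => e e0; near=> n; rewrite sub0r normrN.
have [_] : `|Re (char_fun P (X n) t) -
      \int[P]_w expR (- (`|t| `^ alpha * `|Vn n w|))| <= e /\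
    `|Im (char_fun P (X n) t)| <= e by near: n; exact: near_laplace.
by rewrite char_funE.
Unshelve. all: by end_near. Qed.
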